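(* Let $F$ be a field. For every $\eta\in F[X]$, let $R_{F,\eta}:=F[X,Y,Z,T]/(X^2Y+Z^2+T^3+\eta(X))$, and let $x\in R_{F,\eta}$ denote the image of $X$. Then $\operatorname{AK}(R_{F,\eta}/F)=F[x]$ for every $\eta\in F[X]$. In particular $\operatorname{AK}(R_{F,0}/F)\cong F[X]$, and, up to this identification, the ring of absolute constants of $R_{F,0}$ is unchanged when the defining polynomial $X^2Y+Z^2+T^3$ is translated by any $\eta\in F[X]$.
   Context: $F$ is an arbitrary field (any characteristic), and $X,Y,Z,T$ are indeterminates over $F$. For an $F$-algebra $R$ that is an integral domain, an exponential map of $R$ over $F$ is an $F$-algebra homomorphism $\phi\colon R\to R[U]$ ($U$ an indeterminate) such that (i) composing $\phi$ with the evaluation $U\mapsto 0$ gives the identity of $R$, and (ii) writing $\phi(a)=\sum_{n\ge 0}D_n(a)U^n$ (a finite sum for each $a\in R$), the family $\{D_n\}$ is iterative: $D_i\circ D_j=\binom{i+j}{i}D_{i+j}$ for all $i,j\ge 0$. $\operatorname{Exp}(R/F)$ denotes the set of all such maps, and $R^{\phi}:=\{a\in R : \phi(a)=a\}$. The ring of absolute constants of $R$ over $F$ is $\operatorname{AK}(R/F):=\bigcap_{\phi\in\operatorname{Exp}(R/F)}R^{\phi}$. $F[x]$ denotes the $F$-subalgebra of $R_{F,\eta}$ generated by $x$. *)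

(* Defs.v *)
From HB Require Import structures.
From mathcomp Require Import all_boot all_order all_algebra.
From mathcomp Require Import boolp.
From mathcomp Require Import ring_quotient mpoly.

Set Implicit Arguments.
Unset Strict Implicit.
Unset Printing Implicit Defensive.

Import GRing.Theory.
Local Open Scope ring_scope.
Local Open Scope quotient_scope.

Section ExponentialMaps.
Variables (F : fieldType) (R : comAlgType F).

(* [F]-algebra morphisms [R -> R[U]]: the scaling operator encodes the
   [F]-algebra structure of [{poly R}], i.e. [phi (k *: a) = k%:A *: phi a].
   The definitions below make sense whether or not [R] is a domain. *)
Definition poly_hom := {lrmorphism R -> {poly R} | (in_alg R) \; *:%R}.

Definition poly_hom_coef (phi : poly_hom) (n : nat) (a : R) : R := (phi a)`_n.

Definition is_exponential (phi : poly_hom) : Prop :=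
  (forall a : R, (phi a).[0] = a) /\
  (forall (i j : nat) (a : R),
     poly_hom_coef phi i (poly_hom_coef phi j a) =
     poly_hom_coef phi (i + j)%N a *+ 'C((i + j)%N, i)).

Definition invariants (phi : poly_hom) : {pred R} := [pred a | phi a == a%:P].

Definition AK : {pred R} :=
  [pred a | `[< forall phi : poly_hom,
                  is_exponential phi -> a \in invariants phi >]].

(* The intersection of all [F]-subalgebras of [R] containing [x]. *)
Definition gen_subalg (x : R) : {pred R} :=
  [pred r | `[< forall S : {pred R}, subalg_closed S -> x \in S -> r \in S >]].

Lemma gen_subalgP (x r : R) :
  reflect (exists p : {poly F}, r = horner_alg x p) (r \in gen_subalg x).
Proof.
apply: (iffP (asboolP _)) => [gen_r | [p ->] S [S1 SZ SM] Sx].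
  pose S : {pred R} := [pred r | `[< exists p, r = horner_alg x p >]].
  suff /asboolP[p ->] : r \in S by exists p.
  apply: gen_r; last by apply/asboolP; exists 'X; rewrite horner_algX.
  split=> [|a u v /asboolP[p ->] /asboolP[q ->]
           |u v /asboolP[p ->] /asboolP[q ->]]; apply/asboolP.
  - by exists 1; rewrite rmorph1.
  - by exists (a *: p + q); rewrite rmorphD -mul_polyC rmorphM /= horner_algC mulr_algl.
  - by exists (p * q); rewrite rmorphM.
have S0 : 0 \in S by rewrite -(subrr 1) addrC -scaleN1r SZ.
elim/poly_ind: p => [|p c IH]; first by rewrite rmorph0.
rewrite rmorphD rmorphM /= horner_algX horner_algC addrC.
by apply: (SZ c 1) => //; apply: SM.
Qed.

Lemma AK_subalg_closed : subalg_closed AK.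
Proof.
split=> [|k u v /asboolP Hu /asboolP Hv|u v /asboolP Hu /asboolP Hv];
  apply/asboolP => phi Hphi; rewrite inE.
- by rewrite rmorph1.
- rewrite linearP /= (eqP (Hu _ Hphi)) (eqP (Hv _ Hphi)).
  by rewrite -mul_polyC -polyCM -polyCD mulr_algl.
- by rewrite rmorphM /= (eqP (Hu _ Hphi)) (eqP (Hv _ Hphi)) polyCM.
Qed.

HB.instance Definition _ := GRing.isSubalgClosed.Build F R AK AK_subalg_closed.

(* [AK] as an [F]-algebra in its own right. *)
Record AK_alg := AKAlg { AK_val : R; _ : AK_val \in AK }.

HB.instance Definition _ := [isSub for AK_val].
HB.instance Definition _ := [Choice of AK_alg by <:].
HB.instance Definition _ := [SubChoice_isSubAlgebra of AK_alg by <:].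

End ExponentialMaps.

Arguments AK {F} R _.

Section Hypersurface.
Variables (F : fieldType) (eta : {poly F}).

(* The indeterminates X, Y, Z, T are numbered 0, 1, 2, 3. *)
Definition hyp_poly : {mpoly F[4]} :=
  'X_(0 : 'I_4) ^+ 2 * 'X_(1 : 'I_4) + 'X_(2 : 'I_4) ^+ 2 + 'X_(3 : 'I_4) ^+ 3
  + horner_alg ('X_(0 : 'I_4) : {mpoly F[4]}) eta.

Definition hyp_ideal : {pred {mpoly F[4]}} :=
  [pred p | `[< exists q, p = q * hyp_poly >]].

(* [hyp_poly] vanishes at the point [(1, - eta.[1], 0, 0)]. *)
Lemma hyp_ideal_closed : idealr_closed hyp_ideal.
Proof.
have meval_horner v (p : {poly F}) (u : {mpoly F[4]}) :
    meval v (horner_alg u p) = p.[meval v u].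
  elim/poly_ind: p => [|p c IH]; first by rewrite rmorph0 meval0 horner0.
  rewrite rmorphD rmorphM /= horner_algX horner_algC mevalD mevalM IH.
  by rewrite mevalZ meval1 mulr1 hornerMXaddC.
split.
- by apply/asboolP; exists 0; rewrite mul0r.
- apply/asboolP => -[q].
  pose v (i : 'I_4) : F := if i == 0 then 1 else if i == 1 then - eta.[1] else 0.
  move/(congr1 (meval v)); rewrite meval1 mevalM.
  suff -> : meval v hyp_poly = 0.
    by rewrite mulr0 => /eqP; rewrite oner_eq0.
  rewrite /hyp_poly !mevalD mevalM !rmorphXn /= meval_horner !mevalXU /v /=.
  by rewrite !expr1n mul1r !expr0n /= !addr0 addNr.
- move=> a u v /asboolP[p ->] /asboolP[q ->]; apply/asboolP.
  by exists (a * p + q); rewrite mulrDl mulrA.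
Qed.

HB.instance Definition _ := isIdealr.Build {mpoly F[4]} hyp_ideal hyp_ideal_closed.

Definition hyp_ring := {ideal_quot hyp_ideal}.

HB.instance Definition _ := GRing.ComNzRing.on hyp_ring.

Definition hyp_pi (p : {mpoly F[4]}) : hyp_ring := \pi_({ideal_quot hyp_ideal}) p.

Lemma hyp_pi_is_zmod_morphism : zmod_morphism hyp_pi.
Proof. exact: rmorphB. Qed.

Lemma hyp_pi_is_monoid_morphism : monoid_morphism hyp_pi.
Proof. by split; [exact: rmorph1 | exact: rmorphM]. Qed.

HB.instance Definition _ :=
  GRing.isZmodMorphism.Build {mpoly F[4]} hyp_ring hyp_pi hyp_pi_is_zmod_morphism.
HB.instance Definition _ :=
  GRing.isMonoidMorphism.Build {mpoly F[4]} hyp_ring hyp_pi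
    hyp_pi_is_monoid_morphism.

Definition hyp_scale (k : F) (r : hyp_ring) : hyp_ring := hyp_pi k%:MP * r.

Lemma hyp_scaleA k l r : hyp_scale k (hyp_scale l r) = hyp_scale (k * l) r.
Proof. by rewrite /hyp_scale mulrA -rmorphM /= -mpolyCM. Qed.

Lemma hyp_scale1 : left_id 1 hyp_scale.
Proof. by move=> r; rewrite /hyp_scale rmorph1 mul1r. Qed.

Lemma hyp_scaleDr : right_distributive hyp_scale +%R.
Proof. by move=> k r s; rewrite /hyp_scale mulrDr. Qed.

Lemma hyp_scaleDl r : {morph hyp_scale^~ r : k l / k + l}.
Proof. by move=> k l; rewrite /hyp_scale mpolyCD rmorphD mulrDl. Qed.

HB.instance Definition _ := GRing.Zmodule_isLmodule.Build F hyp_ring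
  hyp_scaleA hyp_scale1 hyp_scaleDr hyp_scaleDl.

Lemma hyp_scaleAl (k : F) (r s : hyp_ring) : k *: (r * s) = (k *: r) * s.
Proof. exact: mulrA. Qed.

HB.instance Definition _ := GRing.Lmodule_isLalgebra.Build F hyp_ring hyp_scaleAl.
HB.instance Definition _ := GRing.Lalgebra_isComAlgebra.Build F hyp_ring.

Lemma hyp_pi_is_scalable : scalable hyp_pi.
Proof. by move=> k p; rewrite -mul_mpolyC rmorphM. Qed.

HB.instance Definition _ :=
  GRing.isScalable.Build F {mpoly F[4]} hyp_ring *:%R hyp_pi hyp_pi_is_scalable.

Lemma hyp_pi_surj (r : hyp_ring) : exists p, r = hyp_pi p.
Proof. by exists (repr r); rewrite /hyp_pi reprK. Qed.

Lemma hyp_pi_eq0 (p : {mpoly F[4]}) :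
  hyp_pi p = 0 <-> exists q, p = q * hyp_poly.
Proof.
rewrite /hyp_pi -[0](rmorph0 hyp_pi) /hyp_pi; split.
  by move/eqP; rewrite -Quotient.idealrBE subr0 => /asboolP.
by move=> Hp; apply/eqP; rewrite -Quotient.idealrBE subr0; apply/asboolP.
Qed.

Definition hyp_x : hyp_ring := hyp_pi 'X_(0 : 'I_4).

End Hypersurface.

(* Main.v *)
(**
  Suppose that an exponential map phi moves x, and let A be its ring of
  invariants. Since A is factorially closed, A meets xR in 0.

  Counting dimensions of spans of monomials shows that A is too large to carry
  a filtration with one-dimensional steps of linear length. Hence A is not
  contained in F[x, z, t] (otherwise A embeds in the coordinate ring of the
  curve z^2 + t^3 + eta(0) = 0), and the leading forms of the elements of A are
  not all scalar multiples of powers of y.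

  Give x, y, z, t the weights -N, 2N+6, 3, 2 with N large. The leading form of
  phi is a nontrivial solution (xh, yh, zh, th) in F[z, t][U] of
  xh^2 yh + zh^2 + th^3 = 0 (after setting x = 1), on which the leading forms of
  elements of A are constant. By the above, yh = y = -(z^2 + t^3), and either xh
  is constant or h(zh, th) is constant for some form h of positive weight, so
  that zh, th or zh^2 + lam th^3 is constant. Each case is excluded: th = t
  because z^2 + t^3 is not a square, the others by applying derivations of
  F[z, t] to the coefficients, which works in every characteristic.

  Conversely, a common invariant of the exponential maps t |-> t + x^2 U and
  z |-> z + x^2 U lies in F[x].
*)

Require Import Defs.
From HB Require Import structures.
From mathcomp Require Import all_boot all_order all_algebra.
From mathcomp Require Import fraction boolp ring_quotient mpoly.
From mathcomp Require Import ring zify.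

Set Implicit Arguments.
Unset Strict Implicit.
Unset Printing Implicit Defensive.

Import Order.TTheory GRing.Theory Num.Theory.
Local Open Scope ring_scope.
Local Open Scope quotient_scope.

(** The weights make [x^2 y], [z^2] and [t^3] homogeneous of the same weight 6, while [eta(x)] has
    weight at most 0 and drops out of the leading form: one degenerate equation serves every [eta].
    [N] only has to exceed the [(z, t)]-degrees of finitely many elements; the weight then compares
    the [y]-degree first and the order in [x] next, so that leading forms are read off from normal
    forms. No graded ring is built. Leading forms are taken along morphisms into the fraction field
    of [F[z, t][U][eps]], with [x], [z], [t] sent to multiples of powers of [eps]. The weight of [U]
    is a maximal slope, hence a fraction, and all weights are multiplied by its denominator [q]. On
    the curves, differentiating the equation exhibits one coordinate as a divisor of something of
    small [U]-degree; which derivation does so depends on whether 2 or 3 vanishes in [F]. Forms in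
    [z^2] and [t^3] are factored over [F] itself: a form constant along a nonconstant curve vanishes
    at its leading coefficients, and repeated leading coefficients produce a root in [F]. *)

Lemma map_poly_derivationM (A : comNzRingType) (d : {additive A -> A})
    (dM : forall a b, d (a * b) = d a * b + a * d b) (p q : {poly A}) :
  map_poly d (p * q) = map_poly d p * q + p * map_poly d q.
Proof.
apply/polyP => i; rewrite coefD !coefM coef_map coefM raddf_sum -big_split /=.
by apply: eq_bigr => j _; rewrite dM !coef_map.
Qed.

Notation pdeg p := (size p).-1.

Lemma lincomb2_eq0 (A : comNzRingType) (a b u v w : A) :
  u = 0 -> v = 0 -> w = a * u + b * v -> w = 0.
Proof. by move=> -> -> ->; rewrite !mulr0 addr0. Qed.

Lemma leq_pdeg (A : nzSemiRingType) (p q : {poly A}) :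
  (size p <= size q)%N -> (pdeg p <= pdeg q)%N.
Proof. by rewrite -!subn1; apply: leq_sub2r. Qed.

Lemma cusp_arith a b : (a * 2 = b * 3 -> a <= b -> b = 0)%N.
Proof. lia. Qed.

Lemma cusp_arith' a b c : (a * 2 = b * 3 -> a <= c -> c <= b -> a = 0)%N.
Proof. lia. Qed.

Section Degree.
Variable A : idomainType.
Implicit Types (p q : {poly A}) (c : A).

Lemma pdeg0_size p : pdeg p = 0%N -> p = (p`_0)%:P.
Proof. by move=> p0; apply: size1_polyC; lia. Qed.

Lemma pdegDC p c : pdeg (p + c%:P) = pdeg p.
Proof.
case: (ltnP 1 (size p)) => sp.
  by rewrite size_polyDl // (leq_ltn_trans (size_polyC_leq1 _)).
by rewrite (size1_polyC sp) -polyCD !size_polyC; do !case: (_ != 0).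
Qed.

Lemma pdegXn p n : pdeg (p ^+ n) = (pdeg p * n)%N.
Proof. exact: size_exp. Qed.

Lemma pdegMC p c : c != 0 -> pdeg (p * c%:P) = pdeg p.
Proof. by move=> c0; rewrite mulrC size_Cmul. Qed.

Lemma pdegM p q : p != 0 -> q != 0 -> pdeg (p * q) = (pdeg p + pdeg q)%N.
Proof.
by move=> p0 q0; rewrite size_mul //; move: p0 q0; rewrite -!size_poly_gt0; lia.
Qed.

Lemma pdeg_dvdC p q c : c != 0 -> p * q = c%:P -> pdeg p = 0%N.
Proof.
move=> c0 pq; have : p * q != 0 by rewrite pq polyC_eq0.
rewrite mulf_eq0 negb_or => /andP[p0 q0].
by have := congr1 (fun r : {poly A} => pdeg r) pq; rewrite pdegM // size_polyC c0 /=; lia.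
Qed.

Lemma leq_pdeg_mul p q r : r != 0 -> p * q = r -> (pdeg p <= pdeg r)%N.
Proof.
move=> + pqr; rewrite -pqr mulf_eq0 negb_or => /andP[p0 q0].
by rewrite pdegM // leq_addr.
Qed.

End Degree.

(** * Polynomial curves on the degenerate hypersurface *)

Section Derivations.
Variables (A : comNzRingType) (d : A -> A).
Hypothesis dD : forall a b, d (a + b) = d a + d b.
Hypothesis dM : forall a b, d (a * b) = d a * b + a * d b.
Implicit Types x y z t l : A.

Lemma derivation_cusp x y z t : x ^+ 2 * y + z ^+ 2 + t ^+ 3 = 0 ->
  x * (2%:R * d x * y + x * d y) + 2%:R * z * d z + 3%:R * t ^+ 2 * d t = 0.
Proof.
have d0 : d 0 = 0 by apply: (addrI (d 0)); rewrite -dD !addr0.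
move/(congr1 d); rewrite d0 => <-.
by rewrite !dD !exprS !expr0 !mulr1 !dM; ring.
Qed.

Lemma derivation_pencil l z t z0 t0 : d l = 0 ->
  z ^+ 2 + l * t ^+ 3 = z0 ^+ 2 + l * t0 ^+ 3 ->
  2%:R * z * d z + 3%:R * l * t ^+ 2 * d t =
  2%:R * z0 * d z0 + 3%:R * l * t0 ^+ 2 * d t0.
Proof.
move=> dl /(congr1 d); rewrite !dD !exprS !expr0 !mulr1 !dM dl => E.
by apply: etrans (etrans _ E) _; ring.
Qed.

Lemma cusp_char3 x y z t : 3%:R = 0 :> A -> d z = 1 ->
  x ^+ 2 * y + z ^+ 2 + t ^+ 3 = 0 ->
  x * (2%:R * d x * y + x * d y) = - 2%:R * z.
Proof.
move=> n3 dz /derivation_cusp; rewrite dz n3 mulr1 !mul0r addr0 => /eqP.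
by rewrite addr_eq0 mulNr => /eqP.
Qed.

(** Taking [t] times the derived relation minus [3 d(t)] times the relation itself cancels [t^3];
    only the [z^2] term is then left without a factor [x]. *)
Lemma cusp_dvd x y z t : d z = 0 -> x ^+ 2 * y + z ^+ 2 + t ^+ 3 = 0 ->
  x * ((2%:R * d x * y + x * d y) * t - 3%:R * x * y * d t) =
  d t * (3%:R * z ^+ 2).
Proof.
move=> dz E; have := derivation_cusp E; rewrite dz mulr0 addr0 => E2.
apply/eqP; rewrite -subr_eq0; apply/eqP.
by apply: (lincomb2_eq0 (a := t) (b := - 3%:R * d t) E2 E); ring.
Qed.

Lemma pencil_char2 l z t z0 t0 : 2%:R = 0 :> A -> d l = 0 -> d t0 = 1 ->
  z ^+ 2 + l * t ^+ 3 = z0 ^+ 2 + l * t0 ^+ 3 -> t * (t * d t * l) = l * t0 ^+ 2.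
Proof.
move=> n2 dl dt0 /(derivation_pencil dl).
have n3 : 3%:R = 1 :> A by rewrite -[3%N]/(2 + 1)%N natrD n2 add0r.
by rewrite dt0 n2 n3 !mul0r !add0r !mul1r mulr1 => <-; ring.
Qed.

Lemma pencil_char3 l z t z0 t0 : 3%:R = 0 :> A -> d l = 0 -> d z0 = 1 ->
  z ^+ 2 + l * t ^+ 3 = z0 ^+ 2 + l * t0 ^+ 3 -> 2%:R * (z * d z) = 2%:R * z0.
Proof.
move=> n3 dl dz0 /(derivation_pencil dl).
by rewrite dz0 n3 !mul0r !addr0 mulr1 mulrA.
Qed.

End Derivations.

(* [D := 3 l t0^2 d - 2 z0 e] kills [z0^2 + l t0^3]. *)
Lemma pencil_dvd (A : comNzRingType) (d e : A -> A)
    (dD : forall a b, d (a + b) = d a + d b)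
    (dM : forall a b, d (a * b) = d a * b + a * d b)
    (eD : forall a b, e (a + b) = e a + e b)
    (eM : forall a b, e (a * b) = e a * b + a * e b) (D : A -> A) (l z t z0 t0 : A) :
  (forall p, D p = d p * (3%:R * l * t0 ^+ 2) - e p * (2%:R * z0)) ->
  d l = 0 -> e l = 0 -> d z0 = 1 -> d t0 = 0 -> e z0 = 0 -> e t0 = 1 ->
  z ^+ 2 + l * t ^+ 3 = z0 ^+ 2 + l * t0 ^+ 3 ->
  z * (3%:R * z * D t - 2%:R * t * D z) = D t * (3%:R * (z0 ^+ 2 + l * t0 ^+ 3)).
Proof.
move=> DE dl el dz dt ez et E.
have := derivation_pencil dD dM dl E; have := derivation_pencil eD eM el E.
rewrite dz dt ez et !mulr0 !mulr1 addr0 add0r => E1 E2; rewrite -E.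
have E3 : 2%:R * z * D z + 3%:R * l * t ^+ 2 * D t = 0.
  transitivity (3%:R * l * t0 ^+ 2 * (2%:R * z * d z + 3%:R * l * t ^+ 2 * d t)
     - 2%:R * z0 * (2%:R * z * e z + 3%:R * l * t ^+ 2 * e t)); first by rewrite !DE; ring.
  by rewrite E1 E2; ring.
apply/eqP; rewrite -subr_eq0; apply/eqP.
by apply: (lincomb2_eq0 (a := - t) (b := 0) E3 E3); ring.
Qed.

Lemma rmorph_natM (A B : comNzRingType) (f : {rmorphism A -> B}) n a :
  f (n%:R * a) = n%:R * f a.
Proof. by rewrite rmorphM rmorph_nat. Qed.

Section Curves.
Variable F : fieldType.
Local Notation D := {poly {poly F}}.
Implicit Types (p q xh yh zh th : {poly D}).

(* [D] is read as [F[z][t]]; [yD] is the value of [y] on the degenerate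
   hypersurface [x^2 y + z^2 + t^3 = 0] cut by [x = 1]. *)
Definition zD : D := 'X%:P.
Definition tD : D := 'X.
Definition yD : D := - (zD ^+ 2 + tD ^+ 3).
Definition cD : {rmorphism F -> D} := polyC \o polyC.

Definition dz : {additive {poly D} -> {poly D}} := map_poly (map_poly (@deriv F)).
Definition dt : {additive {poly D} -> {poly D}} := map_poly (@deriv {poly F}).

Lemma dzM p q : dz (p * q) = dz p * q + p * dz q.
Proof.
apply: map_poly_derivationM => a b /=.
by apply: map_poly_derivationM => u v; exact: derivM.
Qed.

Lemma dtM p q : dt (p * q) = dt p * q + p * dt q.
Proof. by apply: map_poly_derivationM => u v; exact: derivM. Qed.

Lemma dz_C (c : D) : dz c%:P = (map_poly (@deriv F) c)%:P.
Proof. by rewrite /dz /= map_polyC. Qed.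

Lemma dt_C (c : D) : dt c%:P = (c^`())%:P.
Proof. by rewrite /dt /= map_polyC. Qed.

Lemma dz_z : dz zD%:P = 1.
Proof. by rewrite dz_C /zD map_polyC /= derivX. Qed.
Lemma dz_t : dz tD%:P = 0.
Proof.
rewrite dz_C /tD; apply/polyP => i; rewrite coefC coef0; case: i => //=.
apply/polyP => i; rewrite coef_map coefX coef0 /=.
by case: eqP => _; rewrite ?mulr1n ?derivC ?mulr0n // -polyC1 derivC.
Qed.
Lemma dt_z : dt zD%:P = 0.
Proof. by rewrite dt_C /zD derivC. Qed.
Lemma dt_t : dt tD%:P = 1.
Proof. by rewrite dt_C /tD derivX. Qed.
Lemma dz_c (c : F) : dz (cD c)%:P = 0.
Proof. by rewrite dz_C /= map_polyC /= derivC. Qed.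
Lemma dt_c (c : F) : dt (cD c)%:P = 0.
Proof. by rewrite dt_C /= derivC. Qed.

Lemma leq_size_dz p : (size (dz p) <= size p)%N.
Proof. exact: size_poly. Qed.

Lemma leq_size_dt p : (size (dt p) <= size p)%N.
Proof. exact: size_poly. Qed.

Lemma natrD_neq0 n : (n%:R : F) != 0 -> (n%:R : D) != 0.
Proof. by move=> n0; rewrite -!polyC_natr !polyC_eq0. Qed.

Lemma natr_neq0 n : (n%:R : F) != 0 -> (n%:R : {poly D}) != 0.
Proof. by move=> n0; rewrite -!polyC_natr !polyC_eq0. Qed.

Lemma natr_eq0F n : (n%:R : F) = 0 -> (n%:R : {poly D}) = 0.
Proof. by move=> n0; rewrite -!polyC_natr n0 !polyC0. Qed.

Lemma zD_neq0 : zD != 0. Proof. by rewrite polyC_eq0 polyX_eq0. Qed.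
Lemma tD_neq0 : tD != 0. Proof. by rewrite polyX_eq0. Qed.

Lemma size_zt : size (zD ^+ 2 + tD ^+ 3) = 4%N.
Proof.
rewrite addrC size_polyDl ?size_polyXn //.
by rewrite -rmorphXn (leq_ltn_trans (size_polyC_leq1 _)).
Qed.

Lemma yD_neq0 : yD != 0.
Proof. by rewrite oppr_eq0 -size_poly_gt0 size_zt. Qed.

(** Top degrees give [2 deg xh = 3 deg th], so one vanishing degree, or [deg xh <= deg th],
    suffices. In characteristic 3 applying [dz] makes [xh] a divisor of [2 z]; otherwise [dt] makes
    it a divisor of [3 z^2 dt(th)]. *)
Lemma curve_z_const xh th : th`_0 = tD ->
  xh ^+ 2 * yD%:P + zD%:P ^+ 2 + th ^+ 3 = 0 ->
  pdeg xh = 0%N /\ pdeg th = 0%N.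
Proof.
move=> th0 E.
have E2 : xh ^+ 2 * yD%:P = - (th ^+ 3 + (zD ^+ 2)%:P).
  by rewrite polyC_exp; apply/eqP; rewrite -subr_eq0 -E; apply/eqP; ring.
have dg : (pdeg xh * 2 = pdeg th * 3)%N.
  have := congr1 (fun r : {poly D} => pdeg r) E2.
  by rewrite pdegMC ?yD_neq0 // size_polyN pdegDC !pdegXn.
suff : pdeg xh = 0%N \/ pdeg th = 0%N by lia.
have [c3|c3] := eqVneq (3%:R : F) 0.
  left; have n3 := natr_eq0F c3.
  have n2 : (2%:R : F) != 0.
    apply/eqP => c2; move/eqP: c3.
    by rewrite -[3%N]/(2 + 1)%N natrD c2 add0r oner_eq0.
  have := cusp_char3 (raddfD dz) dzM n3 dz_z E.
  rewrite mulNr -(rmorph_natM polyC) -polyCN; apply: pdeg_dvdC.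
  by rewrite oppr_eq0 mulf_neq0 ?zD_neq0 ?natrD_neq0.
right; have E3 := cusp_dvd (raddfD dt) dtM dt_z E.
have dth : dt th != 0.
  apply/eqP => H; have := congr1 (fun p : {poly D} => p`_0) H.
  by rewrite /= coef_map th0 /= derivX coef0 => /eqP; rewrite oner_eq0.
rewrite -polyC_exp -(rmorph_natM polyC) in E3.
have R0 : 3%:R * zD ^+ 2 != 0 by rewrite mulf_neq0 ?natrD_neq0 ?expf_neq0 ?zD_neq0.
have := leq_pdeg_mul _ E3; rewrite pdegMC // mulf_eq0 negb_or dth polyC_eq0 R0.
move=> /(_ isT) /leq_trans => /(_ _ (leq_pdeg (leq_size_dt th))).
by apply: cusp_arith.
Qed.

(** If [xh] were nonconstant, the leading coefficients in [U] would satisfy [b^2 = a^2 (z^2 + t^3)],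
    with even degree in [t] on the left and odd degree on the right. *)
Lemma curve_t_const xh zh :
  xh ^+ 2 * yD%:P + zh ^+ 2 + tD%:P ^+ 3 = 0 ->
  pdeg xh = 0%N /\ pdeg zh = 0%N.
Proof.
move=> E.
have E2 : zh ^+ 2 = xh ^+ 2 * (zD ^+ 2 + tD ^+ 3)%:P + (- tD ^+ 3)%:P.
  apply/eqP; rewrite -subr_eq0 -E; apply/eqP.
  by rewrite polyCN -[X in X%:P]opprK -/yD polyCN polyC_exp; ring.
have zt0 : zD ^+ 2 + tD ^+ 3 != 0 by rewrite -size_poly_gt0 size_zt.
have dg : (pdeg zh * 2 = pdeg xh * 2)%N.
  have := congr1 (fun r : {poly D} => pdeg r) E2.
  by rewrite pdegDC pdegMC // !pdegXn.
suff : ~ (0 < pdeg xh)%N by lia.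
move=> xpos.
have := congr1 lead_coef E2; rewrite lead_coefDl; last first.
  apply: leq_ltn_trans (size_polyC_leq1 _) _.
  have : (pdeg (xh ^+ 2 * (zD ^+ 2 + tD ^+ 3)%:P)%R = pdeg xh * 2)%N by rewrite pdegMC // pdegXn.
  lia.
rewrite (lead_coefM (xh ^+ 2)) lead_coefC !lead_coef_exp => H.
have xl : lead_coef xh != 0 by rewrite lead_coef_eq0; apply/eqP => x0; move: xpos; rewrite x0 size_poly0.
have := congr1 (fun r : D => pdeg r) H.
rewrite pdegXn pdegM ?expf_neq0 // pdegXn size_zt; lia.
Qed.

(** Again [2 deg zh = 3 deg th]. In characteristic 2, [dt] makes [th] a divisor of [lam t^2]; in
    characteristic 3, [dz] makes [zh] a divisor of [z]. Otherwise the derivation killing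
    [z^2 + lam t^3] gives [deg zh <= deg th]. *)
Lemma curve_pencil_const (lam : F) zh th : lam != 0 ->
  zh`_0 = zD -> th`_0 = tD ->
  zh ^+ 2 + (cD lam)%:P * th ^+ 3 = (zD ^+ 2 + cD lam * tD ^+ 3)%:P ->
  pdeg zh = 0%N /\ pdeg th = 0%N.
Proof.
move=> lam0 zh0 th0 E.
have cl0 : cD lam != 0 by rewrite /= !polyC_eq0.
have dg : (pdeg zh * 2 = pdeg th * 3)%N.
  have E2 : zh ^+ 2 = - (th ^+ 3 * (cD lam)%:P) + (zD ^+ 2 + cD lam * tD ^+ 3)%:P.
    by rewrite -E; ring.
  have := congr1 (fun r : {poly D} => pdeg r) E2.
  by rewrite pdegDC size_polyN pdegMC // !pdegXn.
suff : pdeg zh = 0%N \/ pdeg th = 0%N by lia.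
have E2 : zh ^+ 2 + (cD lam)%:P * th ^+ 3 = zD%:P ^+ 2 + (cD lam)%:P * tD%:P ^+ 3.
  by rewrite E -!polyC_exp -polyCM -polyCD.
have [c2|c2] := eqVneq (2%:R : F) 0.
  right; have := pencil_char2 (raddfD dt) dtM (natr_eq0F c2) (dt_c lam) dt_t E2.
  rewrite -polyC_exp -polyCM; apply: pdeg_dvdC.
  by rewrite mulf_neq0 ?expf_neq0 ?tD_neq0.
have [c3|c3] := eqVneq (3%:R : F) 0.
  left; have := pencil_char3 (raddfD dz) dzM (natr_eq0F c3) (dz_c lam) dz_z E2.
  move/(mulfI (natr_neq0 c2)); apply: pdeg_dvdC; exact: zD_neq0.
pose a := 3%:R * cD lam * tD ^+ 2; pose b := 2%:R * zD.
pose d p := dz p * a%:P - dt p * b%:P.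
have dE p : d p = dz p * (3%:R * (cD lam)%:P * tD%:P ^+ 2) - dt p * (2%:R * zD%:P).
  by rewrite /d /a /b (polyCM (3%:R * cD lam)) polyC_exp (rmorph_natM polyC 3%N (cD lam))
             (rmorph_natM polyC 2%N zD).
left; have := pencil_dvd (raddfD dz) dzM (raddfD dt) dtM dE (dz_c lam) (dt_c lam) dz_z dz_t dt_z dt_t E2.
rewrite -E2 E -(rmorph_natM polyC 3%N); set q := 3%:R * (zD ^+ 2 + _) => E4.
(* The [U^0] coefficient of [d th] is [- 2 z], nonzero in this branch. *)
have dth : d th != 0.
  apply/eqP => H; have := congr1 (fun p : {poly D} => p`_0) H.
  rewrite coefB !coefMC !coef_map th0 /= derivX coef0 /tD.
  have -> : map_poly (@deriv F) 'X = 0.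
    by have := dz_t; rewrite dz_C => /eqP; rewrite polyC_eq0 => /eqP.
  rewrite mul0r add0r mul1r => /eqP; rewrite oppr_eq0 mulf_eq0 (negPf zD_neq0) orbF.
  by apply/negP; apply: natrD_neq0.
have q0 : q != 0.
  apply: mulf_neq0; first exact: natrD_neq0.
  have st : size (cD lam * tD ^+ 3) = 4%N.
    by rewrite /= mul_polyC size_scale ?polyC_eq0 // size_polyXn.
  rewrite -size_poly_gt0 addrC size_polyDl st // -rmorphXn.
  by rewrite (leq_ltn_trans (size_polyC_leq1 _)).
have := leq_pdeg_mul _ E4; rewrite pdegMC // mulf_eq0 negb_or dth polyC_eq0 q0.
move=> /(_ isT) L; apply: cusp_arith' dg L _.
have sM p r (c : D) : (size p <= size r)%N -> (size (p * c%:P)%R <= size r)%N.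
  move=> pr; have [->|c0] := eqVneq c 0; first by rewrite polyC0 mulr0 size_poly0.
  by rewrite mulrC size_Cmul.
apply: leq_pdeg; apply: leq_trans (size_polyD _ _) _; rewrite size_polyN geq_max.
by apply/andP; split; apply: sM; [apply: leq_size_dz|apply: leq_size_dt].
Qed.

End Curves.

(** * Binary forms and weighted forms in [z] and [t] *)

Section Forms.
Variable F : fieldType.

(** The map [c] embeds [F] in the ring of evaluation, so that one binary form can be followed
    through [F], [F[z]], [F[z][t]] and [F[z][t][U]]. *)
Definition hform (A : comNzRingType) (c : F -> A) (g : nat -> F) m (u v : A) : A :=
  \sum_(s < m.+1) c (g s) * (u ^+ s * v ^+ (m - s)).

(* The part of weighted degree [j] of [h(z, t)] for the weights [3] of [z] and
   [2] of [t], evaluated at [(u, v)]. *)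
Definition wform (A : comNzRingType) (c : F -> A) (h : {poly {poly F}}) j (u v : A) : A :=
  \sum_(k < j.+1) \sum_(i < j.+1)
    (if (3 * i + 2 * k == j)%N then c h`_k`_i * (u ^+ i * v ^+ k) else 0).

Lemma pdegC (A : nzRingType) (c : A) : pdeg c%:P = 0%N.
Proof. by rewrite size_polyC; case: (_ != _). Qed.

Lemma coefM_top (A : comNzRingType) (p q : {poly A}) d e :
  (size p <= d.+1)%N -> (size q <= e.+1)%N ->
  (p * q)`_(d + e) = p`_d * q`_e /\ (size (p * q)%R <= (d + e).+1)%N.
Proof.
move=> sp sq; split; last first.
  by apply: leq_trans (size_polyMleq _ _) _; lia.
have le : (d < (d + e).+1)%N by rewrite ltnS leq_addr.
rewrite coefM (bigD1 (Ordinal le)) //= addKn big1 ?addr0 // => i ne.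
have {}ne : (i != d :> nat) by apply: contra ne => /eqP H; apply/eqP/val_inj.
have [lt|gt] := ltnP d i; first by rewrite [p`__]nth_default ?mul0r //; apply: leq_trans sp lt.
by rewrite [q`__]nth_default ?mulr0 //; apply: leq_trans sq _; lia.
Qed.

Lemma coefXn_top (A : comNzRingType) (p : {poly A}) d s :
  (size p <= d.+1)%N ->
  (p ^+ s)`_(s * d) = p`_d ^+ s /\ (size (p ^+ s)%R <= (s * d).+1)%N.
Proof.
move=> sp; elim: s => [|s [IH1 IH2]].
  by rewrite !expr0 mul0n coefC size_poly1.
rewrite !exprS mulSn; have [-> ->] := coefM_top sp IH2.
by rewrite IH1.
Qed.

Lemma hform_top (A : comNzRingType) (c : F -> A) g m (p q : {poly A}) d :
  (size p <= d.+1)%N -> (size q <= d.+1)%N ->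
  (hform (polyC \o c) g m p q)`_(m * d) = hform c g m p`_d q`_d.
Proof.
move=> sp sq; rewrite coef_sum; apply: eq_bigr => s _ /=; rewrite coefCM.
have [pE ps] := coefXn_top s sp; have [qE qs] := coefXn_top (m - s) sq.
have [E _] := coefM_top ps qs; congr (_ * _).
by rewrite -pE -qE -E -mulnDl subnKC // -ltnS.
Qed.

Definition hform_has_root (g : nat -> F) m :=
  exists2 r : F, r != 0 & \sum_(s < m.+1) g s * r ^+ s = 0.

(** Nonzero end coefficients force both coordinates of a nontrivial zero to be nonzero, so that it
    can be dehomogenized. *)
Lemma hform_root_field g m (a b : F) : (0 < m)%N -> g 0%N != 0 -> g m != 0 ->
  (a != 0) || (b != 0) -> hform idfun g m a b = 0 -> hform_has_root g m.
Proof.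
move=> m0 g0 gm ab H.
have b0 : b != 0.
  apply: contraTneq ab => b0; rewrite b0 eqxx orbF negbK.
  move: H; rewrite /hform big_ord_recr /= subnn expr0 mulr1 big1 ?add0r => [/eqP|i _].
    by rewrite mulf_eq0 (negPf gm) expf_eq0 m0.
  by rewrite b0 expr0n subn_eq0 leqNgt ltn_ord !mulr0.
have a0 : a != 0.
  apply: contraTneq b0 => a0; rewrite negbK.
  move: H; rewrite /hform big_ord_recl /= expr0 mul1r subn0 big1 ?addr0 => [/eqP|i _].
    by rewrite mulf_eq0 (negPf g0) expf_eq0 m0.
  by rewrite a0 expr0n !(mul0r, mulr0).
exists (a / b); first by rewrite mulf_neq0 ?invr_eq0.
apply: (mulIf (expf_neq0 m b0)); rewrite mul0r -[RHS]H /hform big_distrl.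
apply: eq_bigr => s _ /=; rewrite -mulrA; congr (_ * _).
have -> : b ^+ m = b ^+ s * b ^+ (m - s) by rewrite -exprD subnKC // -ltnS.
by rewrite expr_div_n mulrA divfK ?expf_neq0.
Qed.

(** The coefficients of degree [d], the larger of the two degrees, form a nontrivial zero one
    polynomial ring lower. Iteration brings a zero down to [F] without extending the field. *)
Lemma hform_root_poly (A : comNzRingType) (c : F -> A) g m (p q : {poly A}) d :
  (forall a b : A, (a != 0) || (b != 0) -> hform c g m a b = 0 -> hform_has_root g m) ->
  d = maxn (size p).-1 (size q).-1 -> (p != 0) || (q != 0) ->
  (hform (polyC \o c) g m p q)`_(m * d) = 0 -> hform_has_root g m.
Proof.
move=> IH dE pq; rewrite hform_top; [apply: IH| |]; try lia.
have [lpq|lqp] := leqP (size p) (size q).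
  have q0 : q != 0 by apply: contraTneq pq => q0; move: lpq;
    rewrite q0 size_poly0 leqn0 size_poly_eq0 eqxx => ->.
  apply/orP; right; have -> : d = (size q).-1 by lia.
  by rewrite -lead_coefE lead_coef_eq0.
have p0 : p != 0 by rewrite -size_poly_gt0; lia.
apply/orP; left; have -> : d = (size p).-1 by lia.
by rewrite -lead_coefE lead_coef_eq0.
Qed.

Lemma hform_factor (A : comNzRingType) (c : {rmorphism F -> A}) (g : nat -> F) m (r : F) (u v : A) :
  \sum_(s < m.+1) g s * r ^+ s = 0 ->
  exists w, hform c g m u v = (u - c r * v) * w.
Proof.
move=> gr.
exists (\sum_(s < m.+1) c (g s) * v ^+ (m - s) *
  (\sum_(i < s) u ^+ (s.-1 - i) * (c r * v) ^+ i)).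
rewrite big_distrr /=.
transitivity (\sum_(s < m.+1) (c (g s) * v ^+ (m - s) * (u ^+ s - (c r * v) ^+ s))).
  have H : \sum_(s < m.+1) c (g s) * v ^+ (m - s) * (c r * v) ^+ s = 0.
    transitivity (c (\sum_(s < m.+1) g s * r ^+ s) * v ^+ m); last by rewrite gr rmorph0 mul0r.
    rewrite rmorph_sum big_distrl; apply: eq_bigr => s _ /=.
    have -> : v ^+ m = v ^+ s * v ^+ (m - s) by rewrite -exprD subnKC // -ltnS.
    by rewrite rmorphM rmorphXn exprMn /=; ring.
  rewrite -[LHS]subr0 -[X in _ - X = _]H /hform -sumrB; apply: eq_bigr => s _; ring.
apply: eq_bigr => s _; case: s => [[|s] /= ls].
  by rewrite !expr0 subrr mulr0 big_ord0 !mulr0.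
by rewrite mulrCA; congr (_ * _); rewrite subrXX.
Qed.

Lemma hform_dvdl (A : comNzRingType) (c : {rmorphism F -> A}) g m (u v : A) :
  g 0%N = 0 -> exists w, hform c g m (u ^+ 2) v = u * w.
Proof.
move=> g0; exists (u * \sum_(s < m) c (g s.+1) * (u ^+ 2) ^+ s * v ^+ (m - s.+1)).
rewrite /hform big_ord_recl /= g0 !rmorph0 mul0r add0r mulrA -expr2 big_distrr.
by apply: eq_bigr => s _; rewrite /= [(u ^+ 2) ^+ (bump 0 s)]exprS /=; ring.
Qed.

Lemma hform_dvdr (A : comNzRingType) (c : {rmorphism F -> A}) g m (u v : A) :
  g m = 0 -> exists w, hform c g m u (v ^+ 3) = v * w.
Proof.
move=> gm; exists (v ^+ 2 * \sum_(s < m) c (g s) * u ^+ s * (v ^+ 3) ^+ (m - s).-1).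
rewrite /hform big_ord_recr /= gm !rmorph0 mul0r addr0 mulrA -exprS big_distrr.
apply: eq_bigr => s _ /=; have := ltn_ord s; rewrite -subn_gt0.
by case: (m - s)%N => // r _; rewrite [(v ^+ 3) ^+ r.+1]exprS /=; ring.
Qed.

Lemma wform_z (A : comNzRingType) (c : F -> A) h j (u v : A) :
  odd j -> exists w, wform c h j u v = u * w.
Proof.
move=> oj; exists (\sum_(k < j.+1) \sum_(i < j.+1)
    (if (3 * i + 2 * k == j)%N then c h`_k`_i * (u ^+ i.-1 * v ^+ k) else 0)).
rewrite big_distrr; apply: eq_bigr => k _; rewrite big_distrr; apply: eq_bigr => i _ /=.
case: eqP => E; last by rewrite mulr0.
case: (nat_of_ord i) E => [|i'] E; first by exfalso; lia.
by rewrite /= exprS; ring.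
Qed.

Lemma wform_t (A : comNzRingType) (c : F -> A) h j (u v : A) :
  ~~ (3 %| j)%N -> exists w, wform c h j u v = v * w.
Proof.
move=> oj; exists (\sum_(k < j.+1) \sum_(i < j.+1)
    (if (3 * i + 2 * k == j)%N then c h`_k`_i * (u ^+ i * v ^+ k.-1) else 0)).
rewrite big_distrr; apply: eq_bigr => k _; rewrite big_distrr; apply: eq_bigr => i _ /=.
case: eqP => E; last by rewrite mulr0.
case: (nat_of_ord k) E => [|k'] E; first by exfalso; lia.
by rewrite /= exprS; ring.
Qed.

(** The equation [3 i + 2 k = 6 m] forces [i = 2 s] and [k = 3 (m - s)]. *)
Lemma wform6 (A : comNzRingType) (c : F -> A) h m (u v : A) :
  wform c h (6 * m) u v =
  hform c (fun s => h`_(3 * (m - s))`_(2 * s)) m (u ^+ 2) (v ^+ 3).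
Proof.
rewrite /wform /hform.
pose G (i k : nat) := c h`_k`_i * (u ^+ i * v ^+ k).
transitivity (\sum_(k < (6 * m).+1) \sum_(i < (6 * m).+1) \sum_(s < m.+1)
   (if (nat_of_ord i == 2 * s)%N && (nat_of_ord k == 3 * (m - s))%N then G i k else 0)).
  apply: eq_bigr => k _; apply: eq_bigr => i _.
  case: eqP => E.
    have ls : (i./2 < m.+1)%N by lia.
    rewrite (bigD1 (Ordinal ls)) //= big1 ?addr0 => [|s ne].
      by rewrite ifT //; lia.
    rewrite ifF //; apply: contraNF ne => H; apply/eqP/val_inj => /=; lia.
  rewrite big1 // => s _; rewrite ifF //; apply/negP => H; apply: E.
  have := ltn_ord s; lia.
under eq_bigr do rewrite exchange_big.
rewrite exchange_big; apply: eq_bigr => s _ /=.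
have lk : (3 * (m - s) < (6 * m).+1)%N by lia.
have li : (2 * s < (6 * m).+1)%N by have := ltn_ord s; lia.
rewrite (bigD1 (Ordinal lk)) //= [X in _ + X]big1 ?addr0 => [|k ne]; last first.
  apply: big1 => i _; rewrite ifF //; apply: contraNF ne => H; apply/eqP/val_inj => /=; lia.
rewrite (bigD1 (Ordinal li)) //= [X in _ + X]big1 ?addr0 => [|k ne]; last first.
  rewrite ifF //; apply: contraNF ne => H; apply/eqP/val_inj => /=; lia.
by rewrite !eqxx /= /G !exprM.
Qed.

End Forms.

(** * Curves along which a weighted form is constant *)

Section Hats.
Variable F : fieldType.
Local Notation D := {poly {poly F}}.
Implicit Types (xh yh zh th : {poly D}).

Let cDU : {rmorphism F -> {poly D}} := polyC \o cD F.

Lemma coef0Xn (A : comNzRingType) (p : {poly A}) n : (p ^+ n)`_0 = p`_0 ^+ n.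
Proof. by rewrite -!horner_coef0 horner_exp. Qed.

(* The level sets of a form of positive weighted degree contain only the
   affine lines of [z = const], [t = const] or [z^2 + lam t^3 = const]. *)
Lemma wform_const_cases h j zh th (c : D) :
  (0 < j)%N -> c != 0 -> wform cDU h j zh th = c%:P ->
  [\/ pdeg zh = 0%N, pdeg th = 0%N |
      exists2 lam : F, lam != 0 & pdeg (zh ^+ 2 + (cD F lam)%:P * th ^+ 3) = 0%N].
Proof.
move=> j0 c0 E.
have [oj|ej] := boolP (odd j).
  by have [w wE] := wform_z cDU h zh th oj; constructor 1; apply: pdeg_dvdC c0 _; rewrite -E wE.
have [d3|n3] := boolP (3 %| j)%N; last first.
  by have [w wE] := wform_t cDU h zh th n3; constructor 2; apply: pdeg_dvdC c0 _; rewrite -E wE.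
have jE : j = (6 * (j %/ 6))%N by lia.
move: (j %/ 6)%N jE => m jE; rewrite {}jE in j0 E *.
have m0 : (0 < m)%N by lia.
rewrite wform6 in E; move: (fun s => _) E => g E.
have [gm|gm] := eqVneq (g m) 0.
  have [w wE] := hform_dvdr cDU (zh ^+ 2) th gm.
  by constructor 2; apply: pdeg_dvdC c0 _; rewrite -E wE.
have [g0|g0] := eqVneq (g 0%N) 0.
  have [w wE] := hform_dvdl cDU m zh (th ^+ 3) g0.
  by constructor 1; apply: pdeg_dvdC c0 _; rewrite -E wE.
have [z0|z0] := eqVneq zh 0; first by constructor 1; rewrite z0 size_poly0.
have [zc|zc] := eqVneq (pdeg zh) 0%N; first by constructor 1.
constructor 3; pose d := maxn (pdeg (zh ^+ 2)) (pdeg (th ^+ 3)).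
have dpos : (0 < d)%N by rewrite leq_max pdegXn muln_gt0 lt0n zc.
(* Leading coefficients in [U], then in [t], then in [z] carry the zero down to [F]. *)
have [r r0 gr] : hform_has_root g m.
  have rF (a b : F) := @hform_root_field F g m a b m0 g0 gm.
  have rFp (p q : {poly F}) : (p != 0) || (q != 0) -> hform polyC g m p q = 0 -> hform_has_root g m.
    by move=> pq H; apply: (hform_root_poly (c := idfun) rF erefl pq); rewrite /comp H coef0.
  have rD (p q : D) : (p != 0) || (q != 0) -> hform (polyC \o polyC) g m p q = 0 -> hform_has_root g m.
    by move=> pq H; apply: (hform_root_poly (c := polyC) rFp erefl pq); rewrite H coef0.
  have E' : hform (polyC \o (polyC \o polyC)) g m (zh ^+ 2) (th ^+ 3) = c%:P := E.
  have pq0 : (zh ^+ 2 != 0) || (th ^+ 3 != 0) by rewrite expf_neq0.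
  apply: (hform_root_poly (c := polyC \o polyC) (d := d) rD erefl pq0).
  have md0 : (m * d == 0)%N = false by apply/negbTE; rewrite muln_eq0 negb_or -!lt0n m0 dpos.
  apply: etrans (congr1 (fun p : {poly D} => p`_(m * d)) E') _.
  by rewrite coefC md0.
exists (- r); first by rewrite oppr_eq0.
have [w wE] := hform_factor cDU (zh ^+ 2) (th ^+ 3) gr.
apply: pdeg_dvdC c0 _; rewrite -E wE; congr (_ * _).
by rewrite rmorphN polyCN mulNr.
Qed.

(** A constant [xh] equals 1, and the equation becomes the pencil with [lam = 1]; a constant form
    leads to one of the three curves treated above. Once [zh] and [th] are constant, [xh] divides
    [yD]. *)
Theorem no_affine_line xh zh th h j (c : D) :
  xh`_0 = 1 -> zh`_0 = zD F -> th`_0 = tD F ->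
  xh ^+ 2 * (yD F)%:P + zh ^+ 2 + th ^+ 3 = 0 ->
  pdeg xh = 0%N \/ [/\ (0 < j)%N, c != 0 & wform cDU h j zh th = c%:P] ->
  [/\ pdeg xh = 0%N, pdeg zh = 0%N & pdeg th = 0%N].
Proof.
move=> x0 z0 t0 E.
have pencil (lam : F) : lam != 0 -> pdeg (zh ^+ 2 + (cD F lam)%:P * th ^+ 3) = 0%N ->
    [/\ pdeg xh = 0%N, pdeg zh = 0%N & pdeg th = 0%N].
  move=> lam0 H.
  have [zc tc] : pdeg zh = 0%N /\ pdeg th = 0%N.
    apply: (curve_pencil_const lam0 z0 t0); rewrite {1}(pdeg0_size H).
    by rewrite coefD coefCM !coef0Xn z0 t0.
  split=> //; have xE : xh * (xh * (yD F)%:P) = (yD F)%:P.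
    have zE := pdeg0_size zc; have tE := pdeg0_size tc.
    rewrite z0 in zE; rewrite t0 in tE.
    move/eqP: E; rewrite -addrA addr_eq0 zE tE -(polyC_exp 2 (zD F)) -(polyC_exp 3 (tD F)) -polyCD -polyCN -/(yD F) => /eqP E2.
    by rewrite mulrA -expr2 E2.
  exact: pdeg_dvdC (yD_neq0 F) xE.
case=> [xc|[j0 c0 /(wform_const_cases j0 c0)[zc|tc|[lam lam0 H]]]].
- apply: (pencil 1 (oner_neq0 _)); have xE := pdeg0_size xc; rewrite x0 in xE.
  have -> : zh ^+ 2 + (cD F 1)%:P * th ^+ 3 = (- yD F)%:P.
    move/eqP: E; rewrite rmorph1 mul1r xE expr1n mul1r -addrA addrC addr_eq0 => /eqP ->.
    exact: (esym (polyCN _)).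
  exact: pdegC.
- have zE := pdeg0_size zc; rewrite z0 in zE; rewrite zE in E.
  by have [] := curve_z_const t0 E.
- have tE := pdeg0_size tc; rewrite t0 in tE; rewrite tE in E.
  by have [] := curve_t_const E.
- exact: pencil H.
Qed.

End Hats.

(** * Normal forms *)

Lemma polyext_exists (A B : comNzRingType) (f : {rmorphism A -> B}) (u : B) :
  {g : {rmorphism {poly A} -> B} | g 'X = u & forall c, g c%:P = f c}.
Proof.
exists (horner_eval u \o map_poly f) => [|c] /=.
  by rewrite map_polyX horner_evalE hornerX.
by rewrite map_polyC horner_evalE hornerC.
Qed.

(* [sum a_i X^i |-> sum f(a_i) u^i], opaque because conversion has to compare
   nested evaluations very often. *)
Definition polyext (A B : comNzRingType) (f : {rmorphism A -> B}) (u : B) :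
  {rmorphism {poly A} -> B} := s2val (polyext_exists f u).

Lemma polyextX (A B : comNzRingType) (f : {rmorphism A -> B}) u : polyext f u 'X = u.
Proof. exact: (s2valP (polyext_exists f u)). Qed.

Lemma polyextC (A B : comNzRingType) (f : {rmorphism A -> B}) u c :
  polyext f u c%:P = f c.
Proof. exact: (s2valP' (polyext_exists f u)). Qed.

Lemma polyextZXn (A B : comNzRingType) (f : {rmorphism A -> B}) u c n :
  polyext f u (c *: 'X^n) = f c * u ^+ n.
Proof. by rewrite -mul_polyC rmorphM rmorphXn polyextX polyextC. Qed.

Lemma polyext_reduce (A B : comNzRingType) (f : {rmorphism A -> B}) u (p : {poly A}) a w d m n :
  a = d * w -> f w * u = f m ->
  polyext f u p = polyext f u (p - a *: 'X^(n.+1) + (d * m) *: 'X^n).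
Proof.
move=> -> wm; rewrite rmorphD rmorphB !polyextZXn !rmorphM -wm exprS; ring.
Qed.

Lemma size_reduce (A : nzRingType) (p : {poly A}) m b : size p = m.+2 ->
  (size (p - lead_coef p *: 'X^(m.+1) + b *: 'X^m)%R <= m.+1)%N.
Proof.
move=> sp; apply/leq_sizeP => j.
rewrite coefD coefB !coefZ !coefXn leq_eqVlt => /orP[/eqP <-|lt].
  by rewrite eqxx gtn_eqF // mulr0 addr0 mulr1 lead_coefE sp subrr.
rewrite !gtn_eqF ?mulr0 ?subr0 ?addr0 //; last by lia.
by rewrite nth_default // sp.
Qed.

Lemma polyextE (A B : comNzRingType) (f : {rmorphism A -> B}) u n (p : {poly A}) :
  (size p <= n)%N -> polyext f u p = \sum_(i < n) f p`_i * u ^+ i.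
Proof.
move=> sp; have {1}-> : p = \sum_(i < n) (p`_i)%:P * 'X^i.
  rewrite -{1}(coefK p) poly_def (big_ord_widen _ (fun i => p`_i *: 'X^i) sp) big_mkcond.
  apply: eq_bigr => i _; rewrite mul_polyC; case: ltnP => // le.
  by rewrite nth_default // scale0r.
rewrite rmorph_sum; apply: eq_bigr => i _.
by rewrite rmorphM rmorphXn polyextX polyextC.
Qed.

Lemma rmorph_polyext (A B T : comNzRingType) (f : {rmorphism A -> B}) u
    (g : {rmorphism B -> T}) (h : {rmorphism {poly A} -> T}) :
  g u = h 'X -> (forall c, g (f c) = h c%:P) -> forall p, g (polyext f u p) = h p.
Proof.
move=> gX gC p; elim/poly_ind: p => [|p c IH]; first by rewrite !rmorph0.
by rewrite !rmorphD !rmorphM IH polyextX polyextC gX gC.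
Qed.

Lemma map_poly_MXaddC (A B : nzRingType) (f : {rmorphism A -> B}) p c :
  map_poly f (p * 'X + c%:P) = map_poly f p * 'X + (f c)%:P.
Proof. by rewrite rmorphD rmorphM /= map_polyX map_polyC. Qed.

Lemma horner_alg_MXaddC (F : fieldType) (R : comAlgType F) (x : R) p c :
  horner_alg x (p * 'X + c%:P) = horner_alg x p * x + c%:A.
Proof. by rewrite rmorphD rmorphM /= horner_algX horner_algC. Qed.

(* What is used of [hyp_ring]: its relation, its generators and its universal
   property. *)
Record presentation (F : fieldType) (eta : {poly F}) (R : comAlgType F) (x y z t : R) := {
  pres_rel : x ^+ 2 * y + z ^+ 2 + t ^+ 3 + horner_alg x eta = 0;
  pres_ind : forall P : R -> Prop, (forall c : F, P c%:A) -> P x -> P y -> P z -> P t ->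
    (forall a b, P a -> P b -> P (a + b)) -> (forall a b, P a -> P b -> P (a * b)) ->
    forall r, P r;
  pres_lift : forall (T : comNzRingType) (f : {rmorphism F -> T}) (vx vy vz vt : T),
    vx ^+ 2 * vy + vz ^+ 2 + vt ^+ 3 + (map_poly f eta).[vx] = 0 ->
    exists g : {rmorphism R -> T},
      (forall c : F, g c%:A = f c) /\ [/\ g x = vx, g y = vy, g z = vz & g t = vt]
}.

Section NormalForm.
Variables (F : fieldType) (eta : {poly F}) (R : comAlgType F) (x y z t : R).
Hypothesis pres : presentation eta x y z t.
Local Notation D := {poly {poly F}}.
Local Notation C := {poly {poly {poly F}}}.
Local Notation zD := (zD F).
Local Notation tD := (tD F).

Definition embz : {rmorphism {poly F} -> R} := polyext (in_alg R) z.
Definition embt : {rmorphism D -> R} := polyext embz t.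
Definition embx : {rmorphism C -> R} := polyext embt x.
Definition evy : {rmorphism {poly C} -> R} := polyext embx y.

Lemma embzX : embz 'X = z. Proof. exact: polyextX. Qed.
Lemma embzC c : embz c%:P = c%:A. Proof. exact: polyextC. Qed.
Lemma embtX : embt 'X = t. Proof. exact: polyextX. Qed.
Lemma embtC c : embt c%:P = embz c. Proof. exact: polyextC. Qed.
Lemma embxX : embx 'X = x. Proof. exact: polyextX. Qed.
Lemma embxC c : embx c%:P = embt c. Proof. exact: polyextC. Qed.
Lemma evyX : evy 'X = y. Proof. exact: polyextX. Qed.
Lemma evyC c : evy c%:P = embx c. Proof. exact: polyextC. Qed.

Definition etaX : C := map_poly (cD F) eta.
(** The value of [x^2 y] as a polynomial in [x, z, t]. Its value [W0] at [x = 0] is nonzero, so [y]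
    has a pole of order exactly 2 along [x = 0]. *)
Definition W : C := - ((zD ^+ 2 + tD ^+ 3)%:P + etaX).
Definition W0 : D := - (zD ^+ 2 + tD ^+ 3 + (cD F) eta`_0).

Lemma coef0_W : W`_0 = W0.
Proof. by rewrite /W coefN coefD coefC coef_map. Qed.

Lemma W0_neq0 : W0 != 0.
Proof.
rewrite oppr_eq0 -addrA addrC -addrA addrC.
by rewrite -size_poly_gt0 -rmorphXn /= -polyCD addrC size_polyDl size_polyXn //;
  rewrite (leq_ltn_trans (size_polyC_leq1 _)).
Qed.

Lemma embx_etaX : embx etaX = horner_alg x eta.
Proof.
rewrite /etaX; elim/poly_ind: eta => [|p c IH]; first by rewrite !rmorph0.
rewrite map_poly_MXaddC horner_alg_MXaddC !rmorphD !rmorphM IH embxX embxC.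
by rewrite embtC embzC.
Qed.

Lemma embx_W : x ^+ 2 * y = embx W.
Proof.
have := pres_rel pres; rewrite -!addrA => /eqP; rewrite addr_eq0 => /eqP ->.
rewrite rmorphN rmorphD embx_etaX embxC rmorphD !rmorphXn embtX embtC embzX.
by rewrite addrA.
Qed.

Lemma evy_surj r : exists Q, r = evy Q.
Proof.
apply: (pres_ind pres (P := fun r => exists Q, r = evy Q)) r => [c|||||a b [P ->] [Q ->]|a b [P ->] [Q ->]].
- by exists (c%:P%:P%:P%:P); rewrite evyC embxC embtC embzC.
- by exists ('X%:P); rewrite evyC embxX.
- by exists 'X; rewrite evyX.
- by exists ('X%:P%:P%:P); rewrite evyC embxC embtC embzX.
- by exists ('X%:P%:P); rewrite evyC embxC embtX.
- by exists (P + Q); rewrite rmorphD.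
- by exists (P * Q); rewrite rmorphM.
Qed.

Definition reduced (Q : {poly C}) :=
  (1 < size Q)%N -> ((lead_coef Q)`_0 != 0) || ((lead_coef Q)`_1 != 0).

Lemma coef01_eq0 (A : nzRingType) (c : {poly A}) :
  c`_0 = 0 -> c`_1 = 0 -> exists d, c = d * 'X^2.
Proof.
move=> c0 c1; exists (drop_poly 2 c); rewrite -[LHS](poly_take_drop 2) /=.
rewrite [take_poly 2 c](_ : _ = 0) ?add0r //; apply/polyP => i.
by rewrite coef_take_poly coef0; case: i => [|[|i]].
Qed.

(* Leading [y]-coefficients divisible by [x^2] are removed with [x^2 y = W(x)]. *)
Lemma reduced_form r : exists2 Q, r = evy Q & reduced Q.
Proof.
have [Q ->] := evy_surj r.
have [n] := ubnP (size Q); elim: n Q => // n IH Q sQ.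
have [redQ|] := pselect (reduced Q); first by exists Q.
move/not_implyP => [s1 /negP]; rewrite negb_or !negbK => /andP[/eqP c0 /eqP c1].
have [d dE] := coef01_eq0 c0 c1.
have [m mE] : exists m, size Q = m.+2 by exists (size Q).-2; lia.
pose Q' := Q - lead_coef Q *: 'X^(m.+1) + (d * W) *: 'X^m.
have -> : evy Q = evy Q'.
  by apply: polyext_reduce dE _; rewrite -embx_W rmorphXn embxX.
apply: IH; apply: leq_ltn_trans (size_reduce _ mE) _.
by move: sQ; rewrite mE.
Qed.

(** The universal property allows [y] to be sent to [W / x^2] in the field of rational functions in
    [x, z, t]. That [R] is a domain is deduced later from the injectivity of this map. *)
Lemma iota_exists : exists g : {rmorphism R -> {fraction C}},
  (forall p, g (embx p) = tofrac p) /\ g y * tofrac ('X ^+ 2) = tofrac W.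
Proof.
pose f : {rmorphism F -> {fraction C}} := @tofrac C \o (polyC \o cD F).
have X0 : tofrac ('X ^+ 2 : C) != 0 by rewrite tofrac_eq0 expf_neq0 ?polyX_eq0.
have [|g [gC [gx gy gz gt]]] := pres_lift pres (f := f) (vx := tofrac 'X)
  (vy := tofrac W / tofrac ('X ^+ 2)) (vz := tofrac (zD%:P)) (vt := tofrac (tD%:P)).
  have -> : (map_poly f eta).[tofrac 'X] = tofrac etaX.
    rewrite /etaX; elim/poly_ind: eta => [|p c IH]; first by rewrite !rmorph0 horner0.
    by rewrite !map_poly_MXaddC hornerMXaddC IH !rmorphD !rmorphM.
  rewrite -rmorphXn mulrC divfK // -!rmorphXn -!rmorphD /=.
  by rewrite (_ : _ + _ = 0) ?rmorph0 // /W polyCD !polyC_exp; ring.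
exists g; split; last by rewrite gy divfK.
apply: (rmorph_polyext (h := @tofrac C) gx).
apply: (rmorph_polyext (h := @tofrac C \o polyC) gt).
by apply: (rmorph_polyext (h := @tofrac C \o (polyC \o polyC)) gz) => c; apply: gC.
Qed.

End NormalForm.

(** * Weighted degree in [z] and [t] *)

Section WeightedDegree.
Variable F : fieldType.
Local Notation D := {poly {poly F}}.
Implicit Types h g : D.

Definition degle h j := forall k i, h`_k`_i != 0 -> (3 * i + 2 * k <= j)%N.

Lemma degle_leq h j j' : (j <= j')%N -> degle h j -> degle h j'.
Proof. by move=> le dh k i /dh H; apply: leq_trans H le. Qed.

Lemma degle0 j : degle 0 j.
Proof. by move=> k i; rewrite !coef0 eqxx. Qed.

Lemma degleC (c : F) j : degle (cD F c) j.
Proof. by move=> k i; rewrite coefC; case: k => [|k] /=; rewrite ?coefC ?coef0; case: i => [|i]; rewrite ?eqxx. Qed.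

Lemma degleD h g j : degle h j -> degle g j -> degle (h + g) j.
Proof.
move=> dh dg k i; rewrite !coefD; have [h0|h0 _] := eqVneq (h`_k`_i) 0; last exact: dh.
by rewrite h0 add0r; apply: dg.
Qed.

Lemma degleN h j : degle h j -> degle (- h) j.
Proof. by move=> dh k i; rewrite !coefN oppr_eq0; apply: dh. Qed.

Lemma degle_sum (I : Type) (r : seq I) (P : pred I) (G : I -> D) j :
  (forall i, P i -> degle (G i) j) -> degle (\sum_(i <- r | P i) G i) j.
Proof.
move=> H; apply: (big_ind (fun h => degle h j)) => //; first exact: degle0.
by move=> a b; apply: degleD.
Qed.

Lemma degleM h g j l : degle h j -> degle g l -> degle (h * g) (j + l).
Proof.
move=> dh dg k i; apply: contraNT; rewrite -ltnNge => lt.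
rewrite coefM coef_sum; apply/eqP; apply: big1 => a _; rewrite coefM big1 // => b _.
have [h0|/dh h0] := eqVneq (h`_a`_b) 0; first by rewrite h0 mul0r.
have [g0|/dg g0] := eqVneq (g`_(k - a)`_(i - b)) 0; first by rewrite g0 mulr0.
by exfalso; have := ltn_ord a; have := ltn_ord b; lia.
Qed.

Lemma degle_z : degle (zD F) 3.
Proof.
move=> k i; rewrite coefC; case: k => [|k] /=; last by rewrite coef0 eqxx.
by rewrite coefX; case: i => [|[|i]]; rewrite ?eqxx.
Qed.

Lemma degle_t : degle (tD F) 2.
Proof.
move=> k i; rewrite coefX; case: k => [|[|k]] /=; rewrite ?coef0 ?eqxx //.
by rewrite coefC; case: i => [|i]; rewrite ?eqxx.
Qed.

Lemma degle_ex h : exists j, degle h j.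
Proof.
exists (3 * \max_(k < size h) size (h`_k)%R + 2 * size h)%N => k i hki.
have lk : (k < size h)%N.
  by rewrite ltnNge; apply: contra hki => ?; rewrite [h`__]nth_default ?coef0.
have li : (i < size (h`_k)%R)%N.
  by rewrite ltnNge; apply: contra hki => ?; rewrite [h`_k`__]nth_default.
have := @leq_bigmax _ (fun k : 'I_(size h) => size (h`_k)%R) (Ordinal lk) => /= H.
by apply: leq_add; rewrite leq_mul2l ltnW //; apply: leq_trans li H.
Qed.

Definition degleX (P : {poly D}) j := forall i, degle P`_i j.

Lemma degleXM P Q j l : degleX P j -> degleX Q l -> degleX (P * Q) (j + l).
Proof. by move=> dP dQ i; rewrite coefM; apply: degle_sum => a _; apply: degleM. Qed.

Lemma degleX_ex (P : {poly D}) : exists j, degleX P j.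
Proof.
elim/poly_ind: P => [|P c [j dP]]; first by exists 0%N => i; rewrite coef0; apply: degle0.
have [l dc] := degle_ex c; exists (j + l)%N => i; rewrite coefD coefMX coefC.
apply: degleD; case: i => [|i] /=; try exact: degle0.
  by apply: degle_leq (dP i); apply: leq_addr.
by apply: degle_leq dc; apply: leq_addl.
Qed.

End WeightedDegree.

(** * Embedding in rational functions, and a filtration *)

Section Embedding.
Variables (F : fieldType) (eta : {poly F}) (R : comAlgType F) (x y z t : R).
Hypothesis pres : presentation eta x y z t.
Local Notation D := {poly {poly F}}.
Local Notation C := {poly {poly {poly F}}}.
Local Notation embx := (embx x z t).
Local Notation evy := (evy x y z t).

Definition iotaR : {rmorphism R -> {fraction C}} := sval (cid (iota_exists pres)).

Lemma iota_embx p : iotaR (embx p) = tofrac p.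
Proof. by have [-> _] := svalP (cid (iota_exists pres)). Qed.

Lemma iota_y : iotaR y * tofrac ('X ^+ 2) = tofrac (W eta).
Proof. by have [_ ->] := svalP (cid (iota_exists pres)). Qed.

Lemma iota_x : iotaR x = tofrac 'X.
Proof. by rewrite -(embxX x z t) iota_embx. Qed.

(* [x^(2n) evy Q], rewritten as a polynomial in [x, z, t]. *)
Definition Psi n (Q : {poly C}) : C :=
  \sum_(i < n.+1) Q`_i * (W eta ^+ i * 'X^(2 * (n - i))).

Lemma iota_evy n (Q : {poly C}) : (size Q <= n.+1)%N ->
  iotaR (evy Q) * tofrac 'X ^+ (2 * n) = tofrac (Psi n Q).
Proof.
move=> sQ; rewrite (polyextE _ _ sQ) rmorph_sum big_distrl rmorph_sum.
apply: eq_bigr => i _; rewrite !rmorphM /= iota_embx !rmorphXn /= -iota_y.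
have -> : (2 * n = 2 * i + 2 * (n - i))%N by have := ltn_ord i; lia.
by rewrite -mulrA exprD exprMn -!rmorphXn -exprM; congr (_ * _); rewrite mulrA.
Qed.

(** Modulo [x^2] only the top power of [y] is seen. A reduced leading coefficient is nonzero modulo
    [x^2], which is what makes the embedding injective. *)
Lemma PsiE n (Q : {poly C}) : exists B, Psi n Q = Q`_n * W eta ^+ n + 'X^2 * B.
Proof.
exists (\sum_(i < n) Q`_i * (W eta ^+ i * 'X^(2 * (n - i).-1))).
rewrite /Psi big_ord_recr /= subnn muln0 expr0 mulr1 addrC; congr (_ + _).
rewrite big_distrr; apply: eq_bigr => i _ /=.
have -> : (2 * (n - i) = 2 + 2 * (n - i).-1)%N by have := ltn_ord i; lia.
by rewrite exprD; ring.
Qed.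

Lemma Psi_coef0 n (Q : {poly C}) : (Psi n Q)`_0 = (Q`_n)`_0 * W0 eta ^+ n.
Proof.
have [B ->] := PsiE n Q; rewrite coefD coefXnM /= addr0 -!horner_coef0 hornerM.
by rewrite horner_exp !horner_coef0 coef0_W.
Qed.

Lemma Psi_coef1 n (Q : {poly C}) : (Q`_n)`_0 = 0 -> (Psi n Q)`_1 = (Q`_n)`_1 * W0 eta ^+ n.
Proof.
have [B ->] := PsiE n Q; rewrite coefD coefXnM /= addr0 => q0.
rewrite coefM big_ord_recl big_ord1 /= q0 mul0r add0r; congr (_ * _).
by rewrite -!horner_coef0 horner_exp horner_coef0 coef0_W.
Qed.

Lemma Psi_neq0 n (Q : {poly C}) : size Q = n.+2 -> reduced Q -> Psi n.+1 Q != 0.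
Proof.
move=> sQ; rewrite /reduced sQ lead_coefE sQ /= => /(_ isT).
have W0n := expf_neq0 n.+1 (W0_neq0 eta).
have [q0|q0 _] := eqVneq ((Q`_n.+1)`_0) 0.
  move=> /= q1; apply/eqP => P0; have := Psi_coef1 q0; rewrite P0 coef0 => /esym/eqP.
  by rewrite mulf_eq0 (negPf q1) (negPf W0n).
apply/eqP => P0; have := Psi_coef0 n.+1 Q; rewrite P0 coef0 => /esym/eqP.
by rewrite mulf_eq0 (negPf q0) (negPf W0n).
Qed.

Lemma X_neq0 : tofrac ('X : C) != 0.
Proof. by rewrite tofrac_eq0 polyX_eq0. Qed.

Lemma iota_eq0 r : iotaR r = 0 -> r = 0.
Proof.
have [Q -> redQ] := reduced_form pres r.
have [sQ|s1] := leqP (size Q) 1.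
  by rewrite (size1_polyC sQ) evyC iota_embx => /eqP; rewrite tofrac_eq0 => /eqP ->; rewrite rmorph0.
have [n sQ] : exists n, size Q = n.+2 by exists (size Q).-2; lia.
move=> E; have := @iota_evy n.+1 Q; rewrite sQ E mul0r => /(_ (ltnSn _)) /esym /eqP.
by rewrite tofrac_eq0 (negPf (Psi_neq0 sQ redQ)).
Qed.

Lemma iota_inj : injective iotaR.
Proof. by move=> a b E; apply/eqP; rewrite -subr_eq0; apply/eqP/iota_eq0; rewrite rmorphB E subrr. Qed.

Lemma domain_R (a b : R) : a * b = 0 -> a = 0 \/ b = 0.
Proof.
move/(congr1 iotaR); rewrite rmorphM rmorph0 => /eqP; rewrite mulf_eq0.
by case/orP => /eqP/iota_eq0; [left|right].
Qed.

Lemma mulR_neq0 (a b : R) : a != 0 -> b != 0 -> a * b != 0.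
Proof. by move=> a0 b0; apply/eqP => /domain_R[] /eqP; apply/negP. Qed.

Lemma embx_inj : injective embx.
Proof. by move=> p q /(congr1 iotaR); rewrite !iota_embx => /eqP; rewrite tofrac_eq => /eqP. Qed.

Lemma x_neq0 : x != 0.
Proof. by apply/eqP => x0; have := X_neq0; rewrite -iota_x x0 rmorph0 eqxx. Qed.

(** One index bounds both the pole order along [x = 0] and the [(z, t)]-degree, on the model of
    [y = W / x^2] with pole order 2 and weight 6. The degree in [x] is left free. *)
Definition Fil M r :=
  exists2 P : C, iotaR r * tofrac 'X ^+ (2 * M) = tofrac P & degleX P (6 * M).

Lemma Fil_leq M N r : (M <= N)%N -> Fil M r -> Fil N r.
Proof.
move=> le [P E dP]; exists (P * 'X^(2 * (N - M))).
  by rewrite rmorphM /= -E rmorphXn /= -mulrA -exprD -mulnDr subnKC.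
move=> i; rewrite coefMXn; case: ltnP => _; first exact: degle0.
by apply: degle_leq (dP _); rewrite leq_mul2l.
Qed.

Lemma Fil0 M : Fil M 0.
Proof. by exists 0 => [|i]; rewrite ?rmorph0 ?mul0r // coef0; apply: degle0. Qed.

Lemma FilD M r s : Fil M r -> Fil M s -> Fil M (r + s).
Proof.
move=> [P E dP] [Q E' dQ]; exists (P + Q); first by rewrite !rmorphD /= -E -E' mulrDl.
by move=> i; rewrite coefD; apply: degleD.
Qed.

Lemma FilM M N r s : Fil M r -> Fil N s -> Fil (M + N) (r * s).
Proof.
move=> [P E dP] [Q E' dQ]; exists (P * Q); last by rewrite mulnDr; apply: degleXM.
by rewrite !rmorphM /= -E -E' mulnDr exprD mulrACA.
Qed.

Lemma Fil_sum M (I : Type) (r : seq I) (P : pred I) (G : I -> R) :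
  (forall i, P i -> Fil M (G i)) -> Fil M (\sum_(i <- r | P i) G i).
Proof.
by move=> H; apply: (big_ind (Fil M)) => //; [apply: Fil0|move=> a b; apply: FilD].
Qed.

Lemma Fil_embx M c : degleX c (6 * M) -> Fil M (embx c).
Proof.
move=> dc; exists (c * 'X^(2 * M)); first by rewrite iota_embx rmorphM rmorphXn.
by move=> i; rewrite coefMXn; case: ltnP => _; [apply: degle0|apply: dc].
Qed.

Lemma FilC M (c : F) : Fil M c%:A.
Proof.
rewrite -(embzC z) -(embtC z t) -(embxC x z t); apply: Fil_embx => i.
by rewrite coefC; case: i => [|i] /=; [apply: degleC|apply: degle0].
Qed.

Lemma FilZ M (c : F) r : Fil M r -> Fil M (c *: r).
Proof. by move=> Fr; rewrite -mulr_algl -(add0n M); apply: FilM => //; apply: FilC. Qed.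

Lemma Fil_y : Fil 1 y.
Proof.
exists (W eta); first by rewrite -iota_y rmorphXn.
move=> i; rewrite /W coefN; apply: degleN; rewrite coefD coef_map coefC.
apply: degleD; last exact: degleC.
case: i => [|i] /=; last exact: degle0.
apply: degleD; first by apply: (degle_leq (j := 3 + 3)) => //; apply: degleM; apply: degle_z.
apply: (degle_leq (j := 2 + (2 + 2))) => //; rewrite exprS.
by apply: degleM; [|apply: degleM]; apply: degle_t.
Qed.

Lemma Fil_ex r : exists M, Fil M r.
Proof.
apply: (pres_ind pres (P := fun r => exists M, Fil M r)) r => [c|||||a b [M Ha] [N Hb]|a b [M Ha] [N Hb]].
- by exists 0%N; apply: FilC.
- exists 1%N; rewrite -(embxX x z t); apply: Fil_embx => i; rewrite coefX.
  by case: (_ == _); [rewrite -(rmorph1 (cD F)); apply: degleC|apply: degle0].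
- by exists 1%N; apply: Fil_y.
- exists 1%N; rewrite -(embzX z) -(embtC z t) -(embxC x z t); apply: Fil_embx => i; rewrite coefC.
  case: i => [|i] /=; last exact: degle0.
  by apply: (degle_leq _ (@degle_z F)).
- exists 1%N; rewrite -(embtX z t) -(embxC x z t); apply: Fil_embx => i; rewrite coefC.
  case: i => [|i] /=; last exact: degle0.
  by apply: (degle_leq _ (@degle_t F)).
- by exists (M + N)%N; apply: FilD; [apply: Fil_leq Ha; apply: leq_addr|apply: Fil_leq Hb; apply: leq_addl].
- by exists (M + N)%N; apply: FilM.
Qed.

Definition FilP M (P : {poly R}) := forall n, Fil M P`_n.

Lemma FilPM M N P Q : FilP M P -> FilP N Q -> FilP (M + N) (P * Q).
Proof. by move=> FP FQ n; rewrite coefM; apply: Fil_sum => i _; apply: FilM. Qed.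

Lemma FilP1 : FilP 0 1.
Proof.
move=> n; rewrite coef1; case: (_ == _); last exact: Fil0.
by rewrite -[1%:R](scale1r 1); apply: FilC.
Qed.

Lemma FilPX M P k : FilP M P -> FilP (k * M) (P ^+ k).
Proof.
move=> FP; elim: k => [|k IH]; first by rewrite mul0n expr0; apply: FilP1.
by rewrite exprS mulSn; apply: FilPM.
Qed.

Lemma FilP_ex P : exists M, FilP M P.
Proof.
elim/poly_ind: P => [|P c [M FP]]; first by exists 0%N => n; rewrite coef0; apply: Fil0.
have [N Fc] := Fil_ex c; exists (M + N)%N => n; rewrite coefD coefMX coefC.
by apply: FilD; case: n => [|n] /=; try exact: Fil0;
  [apply: Fil_leq (FP n); apply: leq_addr|apply: Fil_leq Fc; apply: leq_addl].
Qed.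

End Embedding.

(** * Size of the ring of invariants *)

Section DimensionBound.
Variables (F : fieldType) (V : lmodType F).

(** A dimension bound for a mere predicate, phrased through linear dependence so that neither a
    subspace nor a basis has to be exhibited. *)
Definition dimle n (P : V -> Prop) :=
  forall (I : finType) (S : {set I}) (v : I -> V), (n < #|S|)%N ->
    (forall i, i \in S -> P (v i)) ->
    exists2 c : I -> F, (exists2 i, i \in S & c i != 0) & \sum_(i in S) c i *: v i = 0.

Lemma dimle_sub n (P Q : V -> Prop) : (forall v, P v -> Q v) -> dimle n Q -> dimle n P.
Proof. by move=> PQ dQ I S v nS Pv; apply: dQ => // i /Pv/PQ. Qed.

Lemma dimle0 (P : V -> Prop) : (forall v, P v -> v = 0) -> dimle 0 P.
Proof.
move=> P0 I S v; rewrite card_gt0 => /set0Pn[i iS] Pv.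
exists (fun=> 1); first by exists i => //; apply: oner_neq0.
by rewrite big1 // => j /Pv/P0 ->; rewrite scaler0.
Qed.

(** One step of elimination: a member outside [P] serves as pivot, and a relation among the
    corrected vectors is unfolded into one among the original ones. *)
Lemma dimleS n (P Q : V -> Prop) :
  (forall a b, Q a -> Q b -> P a \/ exists c : F, P (b - c *: a)) ->
  dimle n P -> dimle n.+1 Q.
Proof.
move=> step dP I S v nS Qv.
have [allP|/existsNP[i /not_implyP[iS nPi]]] := pselect (forall i, i \in S -> P (v i)).
  by apply: dP => //; apply: ltnW.
have /choice[c cP] : forall j, exists c : F, j \in S -> P (v j - c *: v i).
  move=> j; have [jS|_] := boolP (j \in S); last by exists 0.
  by have [//|[c Pc]] := step _ _ (Qv i iS) (Qv j jS); exists c.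
have [||e [j jS ej] sum0] := dP I (S :\ i) (fun j => v j - c j *: v i).
- by move: nS; rewrite (cardsD1 i) iS.
- by move=> j; rewrite !inE => /andP[_]; apply: cP.
move: jS; rewrite !inE => /andP[ji jS].
pose e' k := if k == i then - \sum_(j in S :\ i) e j * c j else e k.
exists e'; first by exists j => //; rewrite /e' (negPf ji).
rewrite (bigD1 i) //= {1}/e' eqxx.
transitivity (\sum_(j in S :\ i) e j *: (v j - c j *: v i)); last exact: sum0.
under [RHS]eq_bigr do rewrite scalerBr scalerA.
rewrite sumrB -scaler_suml scaleNr addrC; congr (_ - _).
apply: eq_big => [k|k /andP[_ ki]]; first by rewrite !inE andbC.
by rewrite /e' (negPf ki).
Qed.

End DimensionBound.

(** * Invariants of an exponential map *)

Section Exponential.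
Variables (F : fieldType) (eta : {poly F}) (R : comAlgType F) (x y z t : R).
Hypothesis pres : presentation eta x y z t.
Variable phi : poly_hom R.
Hypothesis expphi : is_exponential phi.
Local Notation embx := (embx x z t).

Definition phinv a := phi a = a%:P.

Lemma phi_coef0 a : (phi a)`_0 = a.
Proof. by rewrite -horner_coef0; case: expphi. Qed.

Lemma phinv_size a : (size (phi a) <= 1)%N -> phinv a.
Proof. by move/size1_polyC; rewrite phi_coef0. Qed.

Lemma phiZ (c : F) a : phi (c *: a) = c%:A *: phi a.
Proof. by rewrite linearZ. Qed.

Lemma phiD a b : phi (a + b) = phi a + phi b. Proof. exact: rmorphD. Qed.
Lemma phiB a b : phi (a - b) = phi a - phi b. Proof. exact: rmorphB. Qed.
Lemma phiN a : phi (- a) = - phi a. Proof. exact: rmorphN. Qed.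
Lemma phiM a b : phi (a * b) = phi a * phi b. Proof. exact: rmorphM. Qed.
Lemma phi0 : phi 0 = 0. Proof. exact: rmorph0. Qed.
Lemma phi1 : phi 1 = 1. Proof. exact: rmorph1. Qed.
Lemma phiXn a n : phi (a ^+ n) = phi a ^+ n. Proof. exact: rmorphXn. Qed.

Lemma phinv0 : phinv 0. Proof. exact: phi0. Qed.
Lemma phinv1 : phinv 1. Proof. exact: phi1. Qed.
Lemma phinvD a b : phinv a -> phinv b -> phinv (a + b).
Proof. by rewrite /phinv => ia ib; rewrite phiD ia ib -polyCD. Qed.
Lemma phinvN a : phinv a -> phinv (- a).
Proof. by rewrite /phinv => ia; rewrite phiN ia -polyCN. Qed.
Lemma phinvM a b : phinv a -> phinv b -> phinv (a * b).
Proof. by rewrite /phinv => ia ib; rewrite phiM ia ib -polyCM. Qed.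
Lemma phinvZ (c : F) a : phinv a -> phinv (c *: a).
Proof. by rewrite /phinv => ia; rewrite phiZ ia -mul_polyC -polyCM mulr_algl. Qed.
Lemma phinvC (c : F) : phinv c%:A.
Proof. exact/phinvZ/phinv1. Qed.

(** By iterativity [D_i (D_m a)] is a multiple of [D_(i+m) a], which vanishes for [i > 0] since [m]
    bounds the [U]-degree of [phi a]. *)
Lemma phinv_lead a m : (size (phi a) <= m.+1)%N -> phinv (phi a)`_m.
Proof.
move=> sa; apply: phinv_size; apply/leq_sizeP => -[|i] // _.
have [_ /(_ i.+1 m a)] := expphi; rewrite /poly_hom_coef => ->.
by rewrite [(phi a)`__]nth_default ?mul0rn // (leq_trans sa) // addSn ltnS leq_addl.
Qed.

Lemma size_phiM a b : a * b != 0 ->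
  (size (phi a) + size (phi b)).-1 = size (phi (a * b)).
Proof.
move=> ab; rewrite phiM size_proper_mul //.
have nz c : c != 0 -> lead_coef (phi c) != 0.
  by move=> c0; rewrite lead_coef_eq0; apply: contraNneq c0 => H; rewrite -[c]phi_coef0 H coef0.
by apply: (mulR_neq0 pres); apply: nz; apply: contraNneq ab => ->; rewrite ?mul0r ?mulr0.
Qed.

(** Since [R] is a domain the [U]-degree is additive, and a nonzero product of degree 0 has factors
    of degree 0. *)
Lemma phinv_factor a b : a * b != 0 -> phinv (a * b) -> phinv a.
Proof.
move=> ab iab; have := size_phiM ab; rewrite [phi (a * b)]iab size_polyC ab => /= H.
apply: phinv_size.
have b0 : (0 < size (phi b))%N.
  rewrite size_poly_gt0; apply: contraNneq ab => H'.
  by rewrite -[b]phi_coef0 H' coef0 mulr0.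
have arith m n : ((m + n).-1 = 1 -> 0 < n -> m <= 1)%N by lia.
exact: arith H b0.
Qed.

Definition mon (i j k : nat) : R := x ^+ i * z ^+ j * t ^+ k.

Lemma mon_embx i j k : mon i j k = embx ('X^i * (zD F ^+ j * tD F ^+ k)%:P).
Proof.
rewrite rmorphM embxC rmorphM !rmorphXn embxX embtX embtC embzX.
by rewrite mulrA.
Qed.

Lemma coef_zt i j k l : (zD F ^+ i * tD F ^+ j)`_k`_l = ((k == j) && (l == i))%:R.
Proof.
rewrite /zD -polyC_exp coefCM /tD coefXn; case: (k == j); last by rewrite mulr0 coef0.
by rewrite mulr1 coefXn.
Qed.

Lemma mon_free n (c : 'I_n * 'I_n * 'I_n -> F) :
  \sum_u c u *: mon u.1.1 u.1.2 u.2 = 0 -> forall u, c u = 0.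
Proof.
move=> H [[i j] k].
have : embx (\sum_u (cD F (c u))%:P * ('X^(u.1.1) * (zD F ^+ u.1.2 * tD F ^+ u.2)%:P)) = embx 0.
  rewrite rmorph0 -H rmorph_sum; apply: eq_bigr => u _.
  by rewrite rmorphM -mon_embx embxC embtC embzC mulr_algl.
move/(embx_inj pres)/(congr1 (fun p : {poly {poly {poly F}}} => p`_i`_k`_j)).
have E u : ((cD F (c u))%:P * ('X^(u.1.1) * (zD F ^+ u.1.2 * tD F ^+ u.2)%:P))`_i`_k`_j =
    c u * (i == u.1.1 :> nat)%:R * (k == u.2 :> nat)%:R * (j == u.1.2 :> nat)%:R.
  rewrite coefCM coefMC coefXn; case: (_ == u.1.1 :> nat); last by rewrite mul0r !mulr0 !mul0r !coef0.
  rewrite mul1r coefCM coefCM coef_zt mulr1.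
  by case: (_ == u.2 :> nat); case: (_ == u.1.2 :> nat); rewrite ?mulr1 ?mulr0 ?mul0r.
rewrite !coef0 !coef_sum; under eq_bigr do rewrite E.
rewrite (bigD1 (i, j, k)) //= !eqxx !mulr1 big1 ?addr0 // => -[[i' j'] k'] ne /=.
have [ii|_] := eqVneq (i : nat) i'; last by rewrite mulr0 !mul0r.
have [kk|_] := eqVneq (k : nat) k'; last by rewrite mulr0 !mul0r.
have [jj|_] := eqVneq (j : nat) j'; last by rewrite mulr0.
by move: ne; rewrite (val_inj ii) (val_inj jj) (val_inj kk) eqxx.
Qed.

Section Counting.
Variable T : nat -> R -> Prop.
Hypothesis T0 : forall a, T 0 a -> a = 0.
Hypothesis Tstep : forall j a b, T j.+1 a -> T j.+1 b ->
  T j a \/ exists c : F, T j (b - c *: a).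
Variable cst : nat.
Hypothesis Tfil : forall M a, phinv a -> Fil pres M a -> T (cst * M + cst) a.

(** Interpolates between [U]-degree below [m] (at [j = 0]) and [U]-degree at most [m], through the
    position of the coefficient of [U^m] in the chain [T]. *)
Definition level (V : R -> Prop) m j a :=
  [/\ V a, (size (phi a) <= m.+1)%N & T j (phi a)`_m].

Lemma counting (V : R -> Prop) M m :
  (forall a b c, V a -> V b -> V (b - c *: a)) ->
  (forall a, V a -> forall i, Fil pres M (phi a)`_i) ->
  dimle (m * (cst * M + cst)) (fun a => V a /\ (size (phi a) <= m)%N).
Proof.
move=> Vlin VFil; set J := (cst * M + cst)%N.
elim: m => [|m IH].
  rewrite mul0n; apply: dimle0 => a [_]; rewrite leqn0 size_poly_eq0 => /eqP a0.
  by rewrite -[a]phi_coef0 a0 coef0.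
have lev j : dimle (m * J + j) (level V m j).
  elim: j => [|j IHj].
    rewrite addn0; apply: dimle_sub IH => a [Va sa /T0 a0]; split=> //.
    apply/leq_sizeP => k; rewrite leq_eqVlt => /orP[/eqP <- //|lt].
    by rewrite nth_default // (leq_trans sa).
  rewrite addnS; apply: dimleS IHj => a b [Va sa Ta] [Vb sb Tb].
  have [Ta'|[c Tc]] := Tstep Ta Tb; [by left|right; exists c; split; first exact: Vlin].
    rewrite phiB phiZ (leq_trans (size_polyD _ _)) // geq_max size_polyN sb.
    by rewrite (leq_trans (size_scale_leq _ _)).
  by rewrite phiB phiZ coefB coefZ mulr_algl.
rewrite mulSn addnC; apply: dimle_sub (lev J) => a [Va sa]; split=> //.
by apply: Tfil; [apply: phinv_lead|apply: VFil].
Qed.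

(* The [n^3] monomials [x^i z^j t^k] have [U]-degree [O(n)] under [phi], and the
   coefficients lie in [Fil (O(n))]. As the leading coefficients in [U] are
   invariants, the chain [T] bounds the dimension of their span by [O(n^2)]. *)
Lemma not_counting : False.
Proof.
have [M0 [d [sx sz st [Fx Fz Ft]]]] : exists M0 d,
    [/\ (size (phi x) <= d.+1)%N, (size (phi z) <= d.+1)%N, (size (phi t) <= d.+1)%N &
      [/\ FilP pres M0 (phi x), FilP pres M0 (phi z) & FilP pres M0 (phi t)]].
  have [[[Mx Hx] [Mz Hz]] [Mt Ht]] := (FilP_ex pres (phi x), FilP_ex pres (phi z), FilP_ex pres (phi t)).
  exists (Mx + Mz + Mt)%N, (size (phi x) + size (phi z) + size (phi t))%N.
  split; [lia|lia|lia|split=> n; [apply: Fil_leq (Hx n)|apply: Fil_leq (Hz n)|apply: Fil_leq (Ht n)]]; lia.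
pose bound n := (3 * n * d + 1)%N.
have sX (p : {poly R}) n i : (size p <= d.+1)%N -> (i <= n)%N -> (size (p ^+ i)%R <= (n * d).+1)%N.
  move=> sp le; have [_ H] := coefXn_top i sp; apply: leq_trans H _.
  by rewrite ltnS leq_mul2r le orbT.
have smon n i j k : (i <= n)%N -> (j <= n)%N -> (k <= n)%N -> (size (phi (mon i j k)) <= bound n)%N.
  move=> li lj lk; rewrite !phiM !phiXn.
  have [_ H1] := coefM_top (sX _ _ _ sx li) (sX _ _ _ sz lj).
  have [_ H2] := coefM_top H1 (sX _ _ _ st lk).
  by apply: leq_trans H2 _; rewrite /bound; lia.
have Fmon n i j k l : (i <= n)%N -> (j <= n)%N -> (k <= n)%N -> Fil pres (3 * n * M0) (phi (mon i j k))`_l.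
  move=> li lj lk; rewrite !phiM !phiXn.
  apply: (Fil_leq _ (FilPM (FilPM (FilPX i Fx) (FilPX j Fz)) (FilPX k Ft) l)).
  by rewrite -!mulnDl leq_mul2r; apply/orP; right; lia.
(* [n^3] has to beat the product of [3 n d + 1] and [cst (3 n M0) + cst], which are at most
   [(3 d + 1) n] and [(3 cst M0 + cst) n]. *)
pose n := ((3 * d + 1) * (3 * cst * M0 + cst) + 1)%N.
pose V a := exists c : 'I_n * 'I_n * 'I_n -> F, a = \sum_u c u *: mon u.1.1 u.1.2 u.2.
have Vlin a b c : V a -> V b -> V (b - c *: a).
  move=> [ca ->] [cb ->]; exists (fun u => cb u - c * ca u).
  by rewrite scaler_sumr -sumrB; apply: eq_bigr => u _; rewrite scalerBl scalerA.
have phi_sum (ca : 'I_n * 'I_n * 'I_n -> F) : phi (\sum_u ca u *: mon u.1.1 u.1.2 u.2) =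
    \sum_u (ca u)%:A *: phi (mon u.1.1 u.1.2 u.2).
  by rewrite -[LHS]/((phi : {rmorphism R -> {poly R}}) _) rmorph_sum; apply: eq_bigr => u _; apply: phiZ.
have VFil a : V a -> forall l, Fil pres (3 * n * M0) (phi a)`_l.
  move=> [ca ->] l; rewrite phi_sum coef_sum; apply: Fil_sum => u _.
  by rewrite coefZ mulr_algl; apply: FilZ; apply: Fmon; apply: ltnW.
have Vsize a : V a -> (size (phi a) <= bound n)%N.
  move=> [ca ->]; rewrite phi_sum; apply: leq_trans (size_sum _ _ _) _.
  apply/bigmax_leqP => u _; apply: leq_trans (size_scale_leq _ _) _.
  by apply: smon; apply: ltnW.
have := counting (m := bound n) Vlin VFil.
pose I := ('I_n * 'I_n * 'I_n)%type.
case/(_ I [set: I] (fun u => mon u.1.1 u.1.2 u.2)).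
- rewrite cardsT !card_prod !card_ord /bound.
  have n0 : (0 < n)%N by rewrite /n addn1.
  have E1 : (3 * n * d + 1 <= (3 * d + 1) * n)%N by nia.
  have E2 : (cst * (3 * n * M0) + cst <= (3 * cst * M0 + cst) * n)%N by nia.
  apply: leq_ltn_trans (leq_mul E1 E2) _.
  rewrite mulnACA [X in (_ < X)%N]mulnC ltn_mul2r muln_gt0 n0 /= /n.
  lia.
- move=> u _; split; last first.
    by apply: smon; apply: ltnW.
  exists (fun v => (v == u)%:R); rewrite (bigD1 u) //= eqxx scale1r big1 ?addr0 // => v /negPf ->.
  by rewrite scale0r.
- move=> c [u _ cu]; under eq_bigl do rewrite inE.
  by move=> /mon_free /(_ u) c0; rewrite c0 eqxx in cu.
Qed.

End Counting.
End Exponential.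

(** * Special invariants when [x] is moved *)

Section Witnesses.
Variables (F : fieldType) (eta : {poly F}) (R : comAlgType F) (x y z t : R).
Hypothesis pres : presentation eta x y z t.
Variable phi : poly_hom R.
Hypothesis expphi : is_exponential phi.
Hypothesis xNinv : ~ phinv phi x.
Local Notation D := {poly {poly F}}.
Local Notation C := {poly {poly {poly F}}}.
Local Notation embt := (embt z t).
Local Notation embx := (embx x z t).
Local Notation evy := (evy x y z t).
Local Notation phinv := (phinv phi).

(** Otherwise factorial closedness would make [x] itself invariant. *)
Lemma phinv_xM r : phinv (x * r) -> x * r = 0.
Proof. by move=> ixr; apply/eqP/negPn/negP => /(phinv_factor pres expphi) /(_ ixr). Qed.

Lemma embx_modx c : exists r, embx c = embt c`_0 + x * r.
Proof.
elim/poly_ind: c => [|c d _]; first by exists 0; rewrite coef0 !rmorph0 mulr0 addr0.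
exists (embx c); rewrite rmorphD rmorphM embxX embxC coefD coefMX coefC /= add0r.
by rewrite addrC mulrC.
Qed.

Lemma horner_alg_modx (p : {poly F}) : exists r, horner_alg x p = (p`_0)%:A + x * r.
Proof.
elim/poly_ind: p => [|p c _]; first by exists 0; rewrite coef0 rmorph0 scale0r mulr0 addr0.
exists (horner_alg x p); rewrite horner_alg_MXaddC coefD coefMX coefC /= add0r.
by rewrite addrC mulrC.
Qed.

Lemma zz_modx : exists r, z ^+ 2 = - t ^+ 3 - (eta`_0)%:A + x * r.
Proof.
have [r rE] := horner_alg_modx eta; have := pres_rel pres; rewrite rE => E.
by exists (- x * y - r); apply/eqP; rewrite -subr_eq0 -[X in _ == X]E; apply/eqP; ring.
Qed.

(* Modulo [x], the ring generated by [z] and [t] has the basis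
   [1, z, t, z t, t^2, z t^2, ...], with one element in each degree. *)
Definition cusp_mon l : R := t ^+ l./2 * z ^+ odd l.

Definition cusp_span L a := exists s : nat -> F, exists r,
  a = \sum_(l < L) s l *: cusp_mon l + x * r.

Lemma cusp_spanD L a b : cusp_span L a -> cusp_span L b -> cusp_span L (a + b).
Proof.
move=> [s [r ->]] [s' [r' ->]]; exists (fun l => s l + s' l); exists (r + r').
by under [in RHS]eq_bigr do rewrite scalerDl; rewrite big_split mulrDr addrACA.
Qed.

Lemma cusp_spanZ L c a : cusp_span L a -> cusp_span L (c *: a).
Proof.
move=> [s [r ->]]; exists (fun l => c * s l); exists (c *: r).
rewrite scalerDr scaler_sumr -scalerAr; congr (_ + _).
by apply: eq_bigr => l _; rewrite scalerA.
Qed.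

Lemma cusp_spanx L r : cusp_span L (x * r).
Proof. by exists (fun=> 0); exists r; rewrite big1 ?add0r // => l _; rewrite scale0r. Qed.

Lemma cusp_span0 L : cusp_span L 0.
Proof. by rewrite -(mulr0 x); apply: cusp_spanx. Qed.

Lemma cusp_span_leq L L' a : (L <= L')%N -> cusp_span L a -> cusp_span L' a.
Proof.
move=> le [s [r ->]]; exists (fun l => if (l < L)%N then s l else 0); exists r.
rewrite (big_ord_widen _ (fun l => s l *: cusp_mon l) le) big_mkcond; congr (_ + _).
by apply: eq_bigr => l _; case: ifP => // _; rewrite scale0r.
Qed.

Lemma cusp_span_mon L l : (l < L)%N -> cusp_span L (cusp_mon l).
Proof.
move=> lL; exists (fun k => (k == l)%:R); exists 0; rewrite mulr0 addr0.
rewrite (bigD1 (Ordinal lL)) //= eqxx scale1r big1 ?addr0 // => k ne.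
by rewrite -val_eqE /= in ne; rewrite (negPf ne) scale0r.
Qed.

(** Modulo [x], trading [z^2] for [- t^3 - eta(0)] never raises [3 i + 2 k]; once [i <= 1] a single
    basis monomial remains. *)
Lemma cusp_span_zt i k L : (3 * i + 2 * k < L)%N -> cusp_span L (z ^+ i * t ^+ k).
Proof.
have [n] := ubnP i; elim: n i k => // n IH [|[|i]] k lin lL.
- rewrite expr0 mul1r -(mulr1 (t ^+ k)).
  have := @cusp_span_mon L (2 * k)%N; rewrite /cusp_mon mul2n doubleK odd_double; apply; lia.
- have := @cusp_span_mon L (2 * k).+1; rewrite /cusp_mon mul2n /= uphalf_double odd_double mulrC; apply; lia.
have [r rE] := zz_modx.
have -> : z ^+ i.+2 * t ^+ k = (-1) *: (z ^+ i * t ^+ (3 + k)) + (- eta`_0) *: (z ^+ i * t ^+ k) +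
    x * (r * (z ^+ i * t ^+ k)).
  rewrite -addn2 exprD rE exprD scaleN1r scaleNr -[eta`_0 *: (_ * _)]mulr_algl; ring.
apply: cusp_spanD (cusp_spanx _ _).
by apply: cusp_spanD; apply: cusp_spanZ; apply: IH; lia.
Qed.

Lemma cusp_span_embt h j : degle h j -> cusp_span j.+1 (embt h).
Proof.
move=> dh; rewrite (polyextE _ _ (leqnn _)).
apply: (big_ind (cusp_span j.+1)) => [|a b|k _]; [exact: cusp_span0|exact: cusp_spanD|].
rewrite (polyextE _ _ (leqnn _)) big_distrl /=.
apply: (big_ind (cusp_span j.+1)) => [|a b|i _]; [exact: cusp_span0|exact: cusp_spanD|].
rewrite mulr_algl -scalerAl.
have [->|/dh le] := eqVneq (h`_k`_i) 0; first by rewrite scale0r; apply: cusp_span0.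
by apply: cusp_spanZ; apply: cusp_span_zt.
Qed.

Lemma phinv_nonpolynomial : exists2 f, phinv f & forall c, f <> embx c.
Proof.
apply/not_exists2P => H.
have {}H f : phinv f -> exists c, f = embx c.
  by move=> invf; have [//|/existsNP[c /contrapT]] := H f; exists c.
apply: (@not_counting _ _ _ _ _ _ _ pres phi expphi (fun j a => phinv a /\ cusp_span j a)) 6%N _.
- move=> a [inva [s [r]]]; rewrite big_ord0 add0r => aE; rewrite aE in inva *.
  exact: phinv_xM.
- move=> j a b [inva [s [r aE]]] [invb [s' [r' bE]]].
  rewrite !big_ord_recr /= in aE bE.
  have [s0|s0] := eqVneq (s j) 0.
    by left; split=> //; exists s; exists r; rewrite aE s0 scale0r addr0.
  right; exists (s' j / s j); split.
    by rewrite -scaleNr; apply: phinvD => //; apply: phinvZ.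
  exists (fun l => s' l - s' j / s j * s l); exists (r' - (s' j / s j) *: r).
  rewrite aE bE; under [in RHS]eq_bigr do rewrite scalerBl -scalerA.
  rewrite sumrB -scaler_sumr !scalerDr scalerA divfK // mulrBr -scalerAr.
  ring.
- move=> M a inva [P E dP]; split=> //.
  have [c aE] := H a inva; have [r cE] := embx_modx c; rewrite aE cE.
  apply: cusp_spanD (cusp_spanx _ _).
  apply: (cusp_span_leq (L := (6 * M).+1)); first by lia.
  (* Here [P] equals [c x^(2M)], so its coefficient of index [2M] is [c] at [x = 0], which inherits
     the degree bound [6M]. *)
  apply: cusp_span_embt; move: E; rewrite aE iota_embx -rmorphXn -rmorphM => /eqP.
  by rewrite tofrac_eq => /eqP PE; have := dP (2 * M)%N; rewrite -PE coefMXn ltnn subnn.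
Qed.

(* The leading form of [evy Q] is not a scalar multiple of a power of [y]. *)
Definition nonmonomial (Q : {poly C}) :=
  (forall k : F, (lead_coef Q)`_0 <> cD F k) \/
  [/\ (1 < size Q)%N, (lead_coef Q)`_0 = 0 & (lead_coef Q)`_1 != 0].

Lemma phinv_polynomial c : phinv (embx c) -> (exists k : F, c`_0 = cD F k) ->
  exists k : F, embx c = k%:A.
Proof.
move=> invc [k kE]; exists k; have [r rE] := embx_modx c.
rewrite rE kE embtC embzC in invc *.
rewrite (phinv_xM (r := r)) ?addr0 //.
have := phinvD invc (phinvN (phinvC phi k)); rewrite addrC addKr; exact.
Qed.

Lemma iota_algC k : iotaR pres k%:A = tofrac (cD F k)%:P.
Proof. by rewrite -(embzC z) -(embtC z t) -(embxC x z t) iota_embx. Qed.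

Lemma iotaZ k a : iotaR pres (k *: a) = tofrac (cD F k)%:P * iotaR pres a.
Proof. by rewrite -iota_algC -rmorphM mulr_algl. Qed.

Section Monomial.
Hypothesis mono : forall f, phinv f ->
  (exists k : F, f = k%:A) \/
  exists n (Q : {poly C}) (k : F),
    [/\ f = evy Q, size Q = n.+2, (lead_coef Q)`_0 = cD F k & k != 0].

(** Index [i.+1] allows a pole of order at most [2 i] along [x = 0]; index 0 is kept for zero alone,
    where the chain of the dimension count has to start. *)
Definition pole j a := phinv a /\
  if j is i.+1 then exists P : C, iotaR pres a * tofrac 'X ^+ (2 * i) = tofrac P else a = 0.

(** A leading form [k y^n] has most polar term [k W0^n x^(-2n)]. Hence the coefficient of [x^(-2j)]
    lies on the line spanned by [W0^j], and the steps of [pole] are one-dimensional. *)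
Lemma pole_lead j a (P : C) : phinv a -> iotaR pres a * tofrac 'X ^+ (2 * j) = tofrac P ->
  exists k : F, P`_0 = cD F k * W0 eta ^+ j /\ (k = 0 -> pole j a).
Proof.
move=> inva E; case: (mono inva) => [[k aE]|[n [Q [k [aE sQ lQ k0]]]]].
  have {}E : P = (cD F k)%:P * 'X^(2 * j).
    apply/eqP; rewrite -tofrac_eq -E aE -(embzC z) -(embtC z t) -(embxC x z t) iota_embx.
    by rewrite tofracM tofracXn.
  case: j E => [|j] E.
    exists k; rewrite E muln0 !expr0 !mulr1 coefC eqxx; split=> // k0.
    by split=> //; rewrite aE k0 scale0r.
  exists 0; rewrite rmorph0 mul0r E coefMXn mulnS; split=> // _; split=> //.
  exists ((cD F k)%:P * 'X^(2 * j)); rewrite aE -(embzC z) -(embtC z t) -(embxC x z t) iota_embx.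
  by rewrite tofracM tofracXn.
have EQ : iotaR pres a * tofrac 'X ^+ (2 * n.+1) = tofrac (Psi eta n.+1 Q).
  by rewrite aE iota_evy // sQ.
have Q0 : (Psi eta n.+1 Q)`_0 = cD F k * W0 eta ^+ n.+1.
  by rewrite Psi_coef0 -lQ lead_coefE sQ.
case: (ltngtP j n.+1) => [lt|gt|jn].
- have : Psi eta n.+1 Q = P * 'X^(2 * (n.+1 - j)).
    apply/eqP; rewrite -tofrac_eq -EQ tofracM -E tofracXn -mulrA -exprD; apply/eqP.
    by congr (_ * _ ^+ _); lia.
  move/(congr1 (fun p : C => p`_0)); rewrite Q0 coefMXn ifT; last by lia.
  move/eqP; rewrite mulf_eq0 expf_eq0 (negPf (W0_neq0 eta)) andbF orbF.
  by rewrite /= !polyC_eq0 (negPf k0).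
- have Ei i : (n.+1 <= i)%N -> iotaR pres a * tofrac 'X ^+ (2 * i) =
      tofrac (Psi eta n.+1 Q * 'X^(2 * (i - n.+1))).
    move=> le; rewrite tofracM -EQ tofracXn -mulrA -exprD.
    by congr (_ * _ ^+ _); lia.
  have PE : P = Psi eta n.+1 Q * 'X^(2 * (j - n.+1)).
    by apply/eqP; rewrite -tofrac_eq -E Ei // ltnW.
  exists 0; rewrite rmorph0 mul0r PE coefMXn ifT; last by lia.
  split=> // _; split=> //; case: j gt {E PE} => // j gt.
  by exists (Psi eta n.+1 Q * 'X^(2 * (j - n.+1))); apply: Ei.
- exists k; split; last by move=> k0'; rewrite k0' eqxx in k0.
  have -> : P = Psi eta n.+1 Q by apply/eqP; rewrite -tofrac_eq -E -EQ jn.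
  by rewrite Q0 jn.
Qed.

Lemma not_monomial : False.
Proof.
apply: (@not_counting _ _ _ _ _ _ _ pres phi expphi pole) 1%N _; first by move=> a [].
- move=> j a b [inva [P PE]] [invb [Q QE]].
  have [k [PE0 ka]] := pole_lead inva PE; have [l [QE0 _]] := pole_lead invb QE.
  have [k0|k0] := eqVneq k 0; first by left; apply: ka.
  right; exists (l / k).
  have invc : phinv (b - (l / k) *: a) by rewrite -scaleNr; apply: phinvD => //; apply: phinvZ.
  have E : iotaR pres (b - (l / k) *: a) * tofrac 'X ^+ (2 * j) =
      tofrac (Q - (cD F (l / k))%:P * P).
    by rewrite rmorphB iotaZ tofracB tofracM -PE -QE; ring.
  have [m [mE mpole]] := pole_lead invc E; apply: mpole; move: mE.
  rewrite coefB coefCM PE0 QE0 mulrA -rmorphM divfK // subrr => /esym/eqP.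
  by rewrite mulf_eq0 expf_eq0 (negPf (W0_neq0 eta)) andbF orbF /= !polyC_eq0 => /eqP.
- by move=> M a inva [P E _]; rewrite mul1n addn1; split=> //; exists P.
Qed.

End Monomial.

Lemma phinv_nonmonomial : exists f Q, [/\ phinv f, f = evy Q & nonmonomial Q].
Proof.
apply: contrapT => H; apply: not_monomial => f invf.
have [Q fE redQ] := reduced_form pres f.
have nQ : ~ nonmonomial Q by move=> nQ; apply: H; exists f, Q.
have [k kE] : exists k : F, (lead_coef Q)`_0 = cD F k.
  by apply: contrapT => nk; apply: nQ; left => k kE; apply: nk; exists k.
have [sQ|s1] := leqP (size Q) 1.
  left; rewrite fE (size1_polyC sQ) evyC; apply: phinv_polynomial.
    by rewrite -(evyC x y z t) -size1_polyC // -fE.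
  by exists k; rewrite -kE lead_coefE; case: (size Q) sQ => [|[|]].
right; exists (size Q).-2, Q, k; split=> //; first by lia.
apply/eqP => k0; apply: nQ; right; split=> //; first by rewrite kE k0 rmorph0.
by have := redQ s1; rewrite kE k0 rmorph0 eqxx.
Qed.

Lemma phinv_positive : exists f Q, [/\ phinv f, f = evy Q, (1 < size Q)%N & reduced Q].
Proof.
have [f invf nf] := phinv_nonpolynomial; have [Q fE redQ] := reduced_form pres f.
exists f, Q; split=> //; rewrite ltnNge; apply/negP => sQ.
by apply: (nf Q`_0); rewrite fE {1}(size1_polyC sQ) evyC.
Qed.

End Witnesses.

(** * Leading forms *)

Section LeadingForm.
Variable A : idomainType.
Local Notation E := {fraction {poly A}}.
Implicit Types (w : int) (e : E) (l : A).

Definition eps : E := tofrac 'X.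

Lemma eps_neq0 : eps != 0.
Proof. by rewrite tofrac_eq0 polyX_eq0. Qed.

(* [e] is [eps^-w (l + O(eps))]. *)
Definition lead w e l := exists2 P : {poly A}, e * eps ^ w = tofrac P & P`_0 = l.

Lemma lead0 w : lead w 0 0.
Proof. by exists 0; rewrite ?mul0r ?rmorph0 ?coef0. Qed.

Lemma leadD w e f l m : lead w e l -> lead w f m -> lead w (e + f) (l + m).
Proof.
move=> [P PE <-] [Q QE <-]; exists (P + Q); last by rewrite coefD.
by rewrite mulrDl PE QE tofracD.
Qed.

Lemma lead_sum w (I : Type) (r : seq I) (P : pred I) (e : I -> E) (l : I -> A) :
  (forall i, P i -> lead w (e i) (l i)) ->
  lead w (\sum_(i <- r | P i) e i) (\sum_(i <- r | P i) l i).
Proof.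
move=> H; apply: (big_ind2 (fun e l => lead w e l)) => //; first exact: lead0.
by move=> e1 l1 e2 l2; apply: leadD.
Qed.

Lemma leadM v w e f l m : lead v e l -> lead w f m -> lead (v + w) (e * f) (l * m).
Proof.
move=> [P PE <-] [Q QE <-]; exists (P * Q).
  by rewrite expfzDr ?eps_neq0 // mulrACA PE QE tofracM.
by rewrite -!horner_coef0 hornerM.
Qed.

Lemma lead_tofrac l : lead 0 (tofrac l%:P) l.
Proof. by exists l%:P; rewrite ?expr0z ?mulr1 // coefC. Qed.

Lemma lead1 : lead 0 1 1.
Proof. by rewrite -[1]tofrac1; apply: lead_tofrac. Qed.

Lemma lead_eps w : lead (- w) (eps ^ w) 1.
Proof. by exists 1; rewrite ?coef1 // -expfzDr ?eps_neq0 // subrr expr0z tofrac1. Qed.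

(** Serves to solve the defining relation for [y] once the images of [x], [z], [t] are chosen. *)
Lemma lead_solve (a : nat) w e l : lead w e l ->
  exists2 f, (eps ^ a%:Z) ^+ 2 * f = - e & lead (w + (a * 2)%N%:Z) f (- l).
Proof.
move=> Le; exists (tofrac (-1)%:P * e * eps ^ (- (a * 2)%N%:Z)).
  rewrite polyCN tofracN tofrac1 mulN1r mulrCA -exprnN -exprnP -exprM.
  by rewrite divff ?mulr1 // expf_neq0 // eps_neq0.
have := leadM (leadM (lead_tofrac (-1)) Le) (lead_eps (- (a * 2)%N%:Z)).
by rewrite add0r opprK mulr1 mulN1r.
Qed.

Lemma leadXn w e l n : lead w e l -> lead (w *+ n) (e ^+ n) (l ^+ n).
Proof.
move=> H; elim: n => [|n IH]; first exact: lead1.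
by rewrite !exprS mulrS; apply: leadM.
Qed.

(** [lead] reads a coefficient at a prescribed weight; above the true weight that coefficient is 0.
    Strictly smaller terms are discarded in this way. *)
Lemma lead_lt v w e l : v < w -> lead v e l -> lead w e 0.
Proof.
move=> vw [P PE _]; have [n nE] : exists n : nat, w = v + n.+1%:Z.
  by exists (absz (w - v)).-1; lia.
exists (P * 'X^(n.+1)); last by rewrite coefMXn.
rewrite nE expfzDr ?eps_neq0 // mulrA PE tofracM; congr (_ * _).
by rewrite tofracXn.
Qed.

Lemma lead_le v w e l : v <= w -> lead v e l ->
  lead w e (if v == w then l else 0).
Proof.
rewrite le_eqVlt => /orP[/eqP -> |vw H]; first by rewrite eqxx.
by rewrite lt_eqF //; apply: lead_lt H.
Qed.

Lemma lead_uniq w e l m : lead w e l -> lead w e m -> l = m.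
Proof.
move=> [P PE <-] [Q QE <-]; have /eqP : tofrac P = tofrac Q by rewrite -PE -QE.
by rewrite tofrac_eq => /eqP ->.
Qed.

Lemma leadMn w v e l : w = v -> lead w e l -> lead v e l. Proof. by move=> ->. Qed.

Lemma lead_eq l m w e : l = m -> lead w e l -> lead w e m. Proof. by move=> ->. Qed.

End LeadingForm.

Section FormAt.
Variable F : fieldType.
Local Notation D := {poly {poly F}}.
Implicit Type h : D.

Lemma degle_coef h j i k : degle h j -> (j < 3 * i + 2 * k)%N -> h`_k`_i = 0.
Proof. by move=> dh lt; apply/eqP/negPn/negP => /dh; rewrite leqNgt lt. Qed.

Lemma coef_wform h j i k : (i <= j)%N -> (k <= j)%N ->
  (wform (cD F) h j (zD F) (tD F))`_k`_i = if (3 * i + 2 * k == j)%N then h`_k`_i else 0.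
Proof.
move=> ij kj; rewrite /wform !coef_sum (bigD1 (Ordinal (kj : (k < j.+1)%N))) //=.
rewrite !coef_sum (bigD1 (Ordinal (ij : (i < j.+1)%N))) //=.
have E (i' k' : nat) : (if (3 * i' + 2 * k' == j)%N
      then cD F h`_k'`_i' * (zD F ^+ i' * tD F ^+ k') else 0)`_k`_i =
    if [&& (3 * i' + 2 * k' == j)%N, k == k' & i == i'] then h`_k'`_i' else 0.
  case: ifP => _ /=; last by rewrite !coef0.
  by rewrite coefCM coefCM coef_zt; case: ifP; rewrite ?mulr1 ?mulr0.
rewrite E !eqxx !andbT big1 => [|i' ne]; last first.
  rewrite E; case: ifP => // /and3P[_ _ /eqP H]; case/negP: ne.
  by apply/eqP/val_inj; rewrite /= H.
rewrite big1 ?addr0 // => k' ne; rewrite !coef_sum big1 // => i' _.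
rewrite E; case: ifP => // /and3P[_ /eqP H _]; case/negP: ne.
by apply/eqP/val_inj; rewrite /= H.
Qed.

(** The least bound [j] is the true weighted degree, so its form cannot vanish; [j = 0] leaves only
    scalars. *)
Lemma wform_neq0 h : h != 0 ->
  exists j, [/\ degle h j, wform (cD F) h j (zD F) (tD F) != 0 &
    (forall k : F, h <> cD F k) -> (0 < j)%N].
Proof.
move=> h0; have [m dm] := degle_ex h.
have ex : exists j, `[< degle h j >] by exists m; apply/asboolP.
case: (ex_minnP ex) => j /asboolP dj jmin; exists j; split=> //; last first.
  move=> nh; rewrite lt0n; apply/eqP => j0; apply: (nh h`_0`_0).
  apply/polyP => k; apply/polyP => i; rewrite /= coefC.
  case: k => [|k] /=; rewrite ?coefC ?coef0 ?if_same; last first.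
    by apply: (degle_coef dj); lia.
  by case: i => [|i] //=; apply: (degle_coef dj); lia.
apply/eqP => w0; have hj i k : (3 * i + 2 * k = j)%N -> h`_k`_i = 0.
  move=> E; have ij : (i <= j)%N by lia.
  have kj : (k <= j)%N by lia.
  by have := coef_wform h ij kj; rewrite w0 !coef0 E eqxx.
case: j dj jmin w0 hj => [|j] dj jmin w0 hj.
  case/eqP: h0; apply/polyP => k; apply/polyP => i; rewrite !coef0.
  apply/eqP/negPn/negP => hki; have := dj _ _ hki => le.
  by case/eqP: hki; apply: hj; lia.
have : (j.+1 <= j)%N.
  apply: jmin; apply/asboolP => k i hki; have := dj _ _ hki.
  rewrite leq_eqVlt => /orP[/eqP H|//].
  by case/eqP: hki; apply: hj.
by rewrite ltnn.
Qed.

Lemma wform_polyC h j :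
  wform (polyC \o cD F) h j (zD F)%:P (tD F)%:P = (wform (cD F) h j (zD F) (tD F))%:P.
Proof.
rewrite /wform rmorph_sum; apply: eq_bigr => k _; rewrite rmorph_sum; apply: eq_bigr => i _.
case: ifP => _; last by rewrite rmorph0.
by rewrite [RHS]rmorphM [X in _ = _ * X]rmorphM !rmorphXn.
Qed.

End FormAt.

Lemma weight_form (q i k : nat) :
  0 + ((q * 3)%N%:Z *+ i + (q * 2)%N%:Z *+ k) = (q * (3 * i + 2 * k))%N%:Z :> int.
Proof. by rewrite !pmulrn !mulrzz !(PoszM, PoszD); ring. Qed.

Lemma weight_scale (q : nat) (a b : int) : (0 < q)%N -> (q%:Z * a < q%:Z * b) = (a < b).
Proof. by move=> q0; rewrite ltr_pM2l. Qed.

(** One [y] less costs [2 N + 6]. This exceeds the sum of the at most [N] that the leading term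
    loses through [x^e] and the at most [J < N] gained in [(z, t)]-degree. *)
Lemma weight_lt_y (q N n i l J j e : nat) : (0 < q)%N -> (J < N)%N -> (e <= 1)%N -> (i < n)%N ->
  (q * ((2 * N + 6) * i + J))%N%:Z - (q * N * l)%N%:Z <
  (q * ((2 * N + 6) * n + j))%N%:Z - (q * N * e)%N%:Z.
Proof.
move=> q0 JN e1 lt.
have -> : (q * ((2 * N + 6) * i + J))%N%:Z - (q * N * l)%N%:Z = q%:Z * (((2 * N + 6) * i + J)%N%:Z - (N * l)%N%:Z) by rewrite !(PoszM, PoszD); ring.
have -> : (q * ((2 * N + 6) * n + j))%N%:Z - (q * N * e)%N%:Z = q%:Z * (((2 * N + 6) * n + j)%N%:Z - (N * e)%N%:Z) by rewrite !(PoszM, PoszD); ring.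
rewrite weight_scale //.
(* Writing the inequalities with explicit gaps [d + 1] and [r + 1] turns the difference of weights
   into a visibly positive natural number. *)
have [d ->] : exists d, n = (i + (d + 1))%N by exists (n - i - 1)%N; lia.
have [r ->] : exists r, N = (J + (r + 1))%N by exists (N - J - 1)%N; lia.
rewrite -subr_gt0 (_ : _ - _ = (r + 1 + (1 - e) * (J + (r + 1)) + 6 +
  (2 * (J + (r + 1)) + 6) * d + j + (J + (r + 1)) * l)%N%:Z); first by lia.
by case: e e1 => [|[|//]] _; rewrite ?subnn ?subn0 !(PoszM, PoszD); ring.
Qed.

(** At equal [y]-degree one more [x] costs [N], more than the [(z, t)]-degree can restore. *)
Lemma weight_lt_x (q N n l J j e : nat) : (0 < q)%N -> (J < N)%N -> (e < l)%N ->
  (q * ((2 * N + 6) * n + J))%N%:Z - (q * N * l)%N%:Z <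
  (q * ((2 * N + 6) * n + j))%N%:Z - (q * N * e)%N%:Z.
Proof.
move=> q0 JN lt.
have -> : (q * ((2 * N + 6) * n + J))%N%:Z - (q * N * l)%N%:Z = q%:Z * (((2 * N + 6) * n + J)%N%:Z - (N * l)%N%:Z) by rewrite !(PoszM, PoszD); ring.
have -> : (q * ((2 * N + 6) * n + j))%N%:Z - (q * N * e)%N%:Z = q%:Z * (((2 * N + 6) * n + j)%N%:Z - (N * e)%N%:Z) by rewrite !(PoszM, PoszD); ring.
rewrite weight_scale //.
have [d ->] : exists d, l = (e + (d + 1))%N by exists (l - e - 1)%N; lia.
have [r ->] : exists r, N = (J + (r + 1))%N by exists (N - J - 1)%N; lia.
rewrite -subr_gt0 (_ : _ - _ = (r + 1 + (J + (r + 1)) * d + j)%N%:Z); first by lia.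
by rewrite !(PoszM, PoszD); ring.
Qed.

Lemma weight_monomial (q N i j l : nat) :
  (q * j)%N%:Z + (- (q * N)%N%:Z) *+ l + (q * (2 * N + 6))%N%:Z *+ i =
  (q * ((2 * N + 6) * i + j))%N%:Z - (q * N * l)%N%:Z :> int.
Proof. by rewrite !pmulrn !mulrzz !(PoszM, PoszD); ring. Qed.

(** * Leading forms along a degenerating morphism *)

Section LeadEval.
Variables (F : fieldType) (eta : {poly F}) (R : comAlgType F) (x y z t : R).
Local Notation D := {poly {poly F}}.
Local Notation C := {poly {poly {poly F}}}.
Local Notation E := {fraction {poly {poly D}}}.
Local Notation embt := (embt z t).
Local Notation embx := (embx x z t).
Local Notation evy := (evy x y z t).
Let cDU : {rmorphism F -> {poly D}} := polyC \o cD F.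

Variables (q N : nat) (Th : R -> E) (xh yh zh th : {poly D}).
Hypothesis ThD : forall a b, Th (a + b) = Th a + Th b.
Hypothesis ThM : forall a b, Th (a * b) = Th a * Th b.
Hypothesis ThC : forall c : F, Th c%:A = tofrac (cDU c)%:P.
Hypothesis q0 : (0 < q)%N.
Hypothesis Lx : lead (- (q * N)%:Z) (Th x) xh.
Hypothesis Ly : lead (q * (2 * N + 6))%:Z (Th y) yh.
Hypothesis Lz : lead (q * 3)%:Z (Th z) zh.
Hypothesis Lt : lead (q * 2)%:Z (Th t) th.

Lemma Th0 : Th 0 = 0.
Proof. by apply: (addrI (Th 0)); rewrite -ThD !addr0. Qed.

Lemma Th_sum (I : Type) (r : seq I) (P : pred I) (e : I -> R) :
  Th (\sum_(i <- r | P i) e i) = \sum_(i <- r | P i) Th (e i).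
Proof. by apply: big_morph; [exact: ThD|exact: Th0]. Qed.

Lemma ThXn a n : Th (a ^+ n) = Th a ^+ n.
Proof.
elim: n => [|n IH]; last by rewrite !exprS ThM IH.
have E1 : cDU 1 = 1 by exact: rmorph1.
by rewrite !expr0 -{1}(scale1r 1) ThC E1 polyC1 tofrac1.
Qed.

Lemma lead_embt h j : degle h j ->
  lead (q * j)%:Z (Th (embt h)) (wform cDU h j zh th).
Proof.
move=> dh.
have sh : (size h <= j.+1)%N.
  apply/leq_sizeP => k jk; apply/polyP => i; rewrite coef0.
  by apply: (degle_coef dh); lia.
have shk k : (size (h`_k)%R <= j.+1)%N.
  by apply/leq_sizeP => i ji; apply: (degle_coef dh); lia.
rewrite (polyextE _ _ sh) Th_sum; apply: lead_sum => k _.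
rewrite (polyextE _ _ (shk k)) ThM Th_sum mulr_suml.
apply: lead_sum => i _; rewrite ThM ThC -mulrA !ThXn.
have [h0|/dh le] := eqVneq (h`_k`_i) 0.
  have c0 : cDU 0 = 0 by exact: rmorph0.
  by rewrite h0 c0 polyC0 tofrac0 !mul0r if_same; apply: lead0.
have L := leadM (lead_tofrac (cDU h`_k`_i)) (leadM (leadXn i Lz) (leadXn k Lt)).
rewrite weight_form in L; have le' : (q * (3 * i + 2 * k))%:Z <= (q * j)%:Z :> int.
  by rewrite lez_nat leq_mul2l le orbT.
by have := lead_le le' L; rewrite eqz_nat eqn_pmul2l.
Qed.

Lemma lead_term i l h J : degle h J ->
  exists m, lead ((q * ((2 * N + 6) * i + J))%:Z - (q * N * l)%:Z) (Th (embt h * x ^+ l * y ^+ i)) m.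
Proof.
move=> dh; exists (wform cDU h J zh th * xh ^+ l * yh ^+ i).
rewrite !ThM !ThXn; apply: leadMn (leadM (leadM (lead_embt dh) (leadXn l Lx)) (leadXn i Ly)).
exact: weight_monomial.
Qed.

(** The dominant part is the lowest [x]-term of the top [y]-coefficient; the two weight comparisons
    make all others smaller. For [n = 0] there is no lower power of [y] to compare with, whence the
    disjunction on [e]. *)
Lemma lead_evy (Q : {poly C}) n e j J :
  size Q = n.+1 -> (forall i, degleX Q`_i J) -> (J < N)%N ->
  (e <= 1)%N || (n == 0)%N -> (forall l, (l < e)%N -> Q`_n`_l = 0) -> degle Q`_n`_e j ->
  lead ((q * ((2 * N + 6) * n + j))%:Z - (q * N * e)%:Z) (Th (evy Q))
    (wform cDU Q`_n`_e j zh th * xh ^+ e * yh ^+ n).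
Proof.
move=> sQ dQ JN e1 low dj; set w := (X in lead X).
pose G i l : {poly D} := if (i == n) && (l == e) then
  wform cDU Q`_n`_e j zh th * xh ^+ e * yh ^+ n else 0.
pose B := (\max_(i < n.+1) size (Q`_i)%R + e).+1.
have -> : wform cDU Q`_n`_e j zh th * xh ^+ e * yh ^+ n = \sum_(i < n.+1) \sum_(l < B) G i l.
  rewrite big_ord_recr /= big1 ?add0r => [|i _]; last first.
    by apply: big1 => l _; rewrite /G ltn_eqF.
  have eB : (e < B)%N by rewrite ltnS leq_addl.
  rewrite (bigD1 (Ordinal eB)) //= big1 ?addr0 /G ?eqxx // => l ne.
  by rewrite -val_eqE /= in ne; rewrite (negPf ne).
have sQ' : (size Q <= n.+1)%N by rewrite sQ.
rewrite (polyextE _ _ sQ') Th_sum; apply: lead_sum => i _.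
have sQi : (size (Q`_i)%R <= B)%N.
  have /= H := @leq_bigmax _ (fun i : 'I_n.+1 => size (Q`_i)%R) i.
  by apply: leq_trans H _; rewrite /B -addnS leq_addr.
rewrite (polyextE _ _ sQi) mulr_suml Th_sum; apply: lead_sum => l _.
rewrite /G; case: eqP => [iE|/eqP ne] /=; last first.
  have [m Lm] := lead_term i l (dQ i l); apply: lead_lt Lm; rewrite /w.
  have := ltn_ord i; rewrite ltnS leq_eqVlt (negPf ne) /= => lt.
  move/orP: e1 => [e1|/eqP n0]; last by move: (leq_trans lt (eq_leq n0)).
  exact: weight_lt_y.
rewrite iE; case: eqP => [lE|/eqP ne] /=.
  rewrite lE /w !ThM !ThXn; apply: leadMn (leadM (leadM (lead_embt dj) (leadXn e Lx)) (leadXn n Ly)).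
  exact: weight_monomial.
case: (ltngtP l e) => [lt|gt|/eqP]; last by rewrite (negPf ne).
  by rewrite low // rmorph0 !mul0r Th0; apply: lead0.
have [m Lm] := lead_term n l (dQ n l); apply: lead_lt Lm.
exact: weight_lt_x.
Qed.

Lemma lead_horner_alg (p : {poly F}) : exists m, lead 0 (Th (horner_alg x p)) m.
Proof.
elim/poly_ind: p => [|p c [m IH]]; first by exists 0; rewrite rmorph0 Th0; apply: lead0.
have L := leadM IH Lx; have le : 0 - (q * N)%:Z <= 0 :> int by rewrite sub0r oppr_le0.
have := leadD (lead_le le L) (lead_tofrac (cDU c)).
by rewrite horner_alg_MXaddC ThD ThM ThC => H; eexists; exact: H.
Qed.

Lemma lead_relation : x ^+ 2 * y + z ^+ 2 + t ^+ 3 + horner_alg x eta = 0 ->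
  xh ^+ 2 * yh + zh ^+ 2 + th ^+ 3 = 0.
Proof.
move/(congr1 Th); rewrite !ThD (ThM (x ^+ 2)) !ThXn Th0 => E.
apply: (lead_uniq (w := (q * 6)%:Z) (e := 0)); last exact: lead0.
rewrite -[X in lead _ _ X]addr0 -E; apply: leadD.
  apply: leadD; last by apply: leadMn (leadXn 3 Lt); rewrite pmulrn mulrzz !PoszM; ring.
  apply: leadD; last by apply: leadMn (leadXn 2 Lz); rewrite pmulrn mulrzz !PoszM; ring.
  by apply: leadMn (leadM (leadXn 2 Lx) Ly); rewrite pmulrn mulrzz !(PoszM, PoszD); ring.
by have [m Lm] := lead_horner_alg eta; apply: lead_lt Lm; rewrite ltz_nat muln_gt0 q0.
Qed.

End LeadEval.

Section Scaling.
Variables (F : fieldType) (eta : {poly F}) (R : comAlgType F) (x y z t : R).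
Hypothesis pres : presentation eta x y z t.
Variables (A : idomainType) (c : {rmorphism F -> A}) (az at_ : A).
Local Notation E := {fraction {poly A}}.

Lemma lead_horner_map (f : {rmorphism F -> E}) (p : {poly F}) (v : E) w m :
  (forall k, f k = tofrac (c k)%:P) -> w <= 0 -> lead w v m ->
  exists l, lead 0 (map_poly f p).[v] l.
Proof.
move=> fC w0 Lv; elim/poly_ind: p => [|p k [l IH]].
  by exists 0; rewrite rmorph0 horner0; apply: lead0.
have le : 0 + w <= 0 by rewrite add0r.
have := leadD (lead_le le (leadM IH Lv)) (lead_tofrac (c k)).
by rewrite map_poly_MXaddC hornerMXaddC fC => H; eexists; exact: H.
Qed.

(** [x], [z], [t] go to [eps^(q N)], [az eps^(-3 q)], [at_ eps^(-2 q)], and the relation then forces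
    [y]; [eta(x)] has too small a weight to enter its leading coefficient. *)
Lemma scaling_morphism q N : (0 < q)%N -> exists th : {rmorphism R -> E},
  [/\ forall k : F, th k%:A = tofrac (c k)%:P,
      lead (- (q * N)%:Z) (th x) 1,
      lead (q * (2 * N + 6))%:Z (th y) (- (az ^+ 2 + at_ ^+ 3)),
      lead (q * 3)%:Z (th z) az & lead (q * 2)%:Z (th t) at_].
Proof.
move=> q0; pose f : {rmorphism F -> E} := @tofrac _ \o (polyC \o c).
pose vx : E := eps A ^ (q * N)%:Z.
pose vz : E := tofrac az%:P * eps A ^ (- (q * 3)%:Z).
pose vt : E := tofrac at_%:P * eps A ^ (- (q * 2)%:Z).
have Lx : lead (- (q * N)%:Z) vx 1 by apply: lead_eps.
have Lz : lead (q * 3)%:Z vz az.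
  by have := leadM (lead_tofrac az) (lead_eps A (- (q * 3)%:Z)); rewrite add0r opprK mulr1.
have Lt : lead (q * 2)%:Z vt at_.
  by have := leadM (lead_tofrac at_) (lead_eps A (- (q * 2)%:Z)); rewrite add0r opprK mulr1.
have L6 : lead (q * 6)%:Z (vz ^+ 2 + vt ^+ 3 + (map_poly f eta).[vx]) (az ^+ 2 + at_ ^+ 3 + 0).
  have w0 : - (q * N)%:Z <= 0 by rewrite oppr_le0.
  have [l Ll] := lead_horner_map (f := f) eta (fun k => erefl) w0 Lx.
  apply: leadD; last by apply: lead_lt Ll; rewrite ltz_nat muln_gt0 q0.
  apply: leadD; last by apply: leadMn (leadXn 3 Lt); rewrite pmulrn mulrzz !PoszM; ring.
  by apply: leadMn (leadXn 2 Lz); rewrite pmulrn mulrzz !PoszM; ring.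
have [vy vyE Ly] := lead_solve (q * N) L6.
have [|g [gC [gx gy gz gt]]] := pres_lift pres (f := f) (vx := vx) (vy := vy) (vz := vz) (vt := vt).
  by rewrite vyE -!addrA addNr.
exists g; split; rewrite ?gx ?gy ?gz ?gt //.
by rewrite addr0 in Ly; apply: leadMn Ly; rewrite !(PoszM, PoszD); ring.
Qed.

End Scaling.

(** * The leading form of an exponential map *)

Section Degeneration.
Variables (F : fieldType) (eta : {poly F}) (R : comAlgType F) (x y z t : R).
Hypothesis pres : presentation eta x y z t.
Local Notation D := {poly {poly F}}.
Local Notation C := {poly {poly {poly F}}}.
Local Notation E := {fraction {poly {poly D}}}.
Local Notation evy := (evy x y z t).
Local Notation eps := (eps {poly D}).
Let cDU : {rmorphism F -> {poly D}} := polyC \o cD F.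

Record scaling (q N : nat) (th : {rmorphism R -> E}) : Prop := Scaling {
  scalingC : forall c : F, th c%:A = tofrac (cDU c)%:P;
  scaling_x : lead (- (q * N)%:Z) (th x) 1;
  scaling_y : lead (q * (2 * N + 6))%:Z (th y) (yD F)%:P;
  scaling_z : lead (q * 3)%:Z (th z) (zD F)%:P;
  scaling_t : lead (q * 2)%:Z (th t) (tD F)%:P
}.

Lemma scaling_exists q N : (0 < q)%N -> exists th, scaling q N th.
Proof.
move=> q0; have [th [thC Lx Ly Lz Lt]] := scaling_morphism pres cDU (zD F)%:P (tD F)%:P N q0.
have yE : (yD F)%:P = - ((zD F)%:P ^+ 2 + (tD F)%:P ^+ 3).
  by rewrite /yD polyCN polyCD !polyC_exp.
exists th; apply: Scaling.
- exact: thC.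
- exact: Lx.
- exact: lead_eq (esym yE) Ly.
- exact: Lz.
- exact: Lt.
Qed.

Lemma lead_index (Q : {poly C}) n : size Q = n.+1 -> reduced Q ->
  exists e, [/\ (e <= 1)%N || (n == 0)%N, forall l, (l < e)%N -> Q`_n`_l = 0 & Q`_n`_e != 0].
Proof.
move=> sQ redQ; have cn0 : Q`_n != 0.
  by have : lead_coef Q != 0; [rewrite lead_coef_eq0 -size_poly_gt0 sQ|rewrite lead_coefE sQ].
have ex : exists e, Q`_n`_e != 0.
  by exists (size Q`_n).-1; rewrite -lead_coefE lead_coef_eq0.
case: (ex_minnP ex) => e Qe emin; exists e; split=> //; last first.
  by move=> l le; apply/eqP/negPn/negP => /emin; rewrite leqNgt le.
case: n sQ cn0 ex Qe emin => [|n] sQ _ _ Qe emin; first by rewrite eqxx orbT.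
have := redQ; rewrite /reduced sQ lead_coefE sQ => /(_ isT) /orP[] /emin.
  by rewrite leqn0 => /eqP ->.
by move=> ->.
Qed.

Lemma degleX_uniform (Q : {poly C}) : exists J, forall i, degleX Q`_i J.
Proof.
elim/poly_ind: Q => [|P c [J dP]].
  by exists 0%N => i k; rewrite !coef0; apply: degle0.
have [l dc] := degleX_ex c; exists (J + l)%N => i k; rewrite coefD coefMX coefC coefD.
apply: degleD; case: i => [|i] /=; rewrite ?coef0; try exact: degle0.
  by apply: degle_leq (dP i k); apply: leq_addr.
by apply: degle_leq (dc k); apply: leq_addl.
Qed.

(** The weight [w] and the form [l] are uniform in [q] and [th], because [q] is found only
    afterwards, from the weights of the coefficients of [phi]. *)
Lemma lead_exists (r : R) : exists N0, r != 0 -> forall N, (N0 <= N)%N ->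
  exists w : int, exists2 l : D, l != 0 &
    forall q th, (0 < q)%N -> scaling q N th -> lead (q%:Z * w) (th r) l%:P.
Proof.
have [->|r0] := eqVneq r 0; first by exists 0%N.
have [Q rE redQ] := reduced_form pres r; have [J dQ] := degleX_uniform Q.
have [n sQ] : exists n, size Q = n.+1.
  exists (size Q).-1; rewrite prednK // size_poly_gt0.
  by apply: contraNneq r0 => Q0; rewrite rE Q0 rmorph0.
have [e [e1 low he]] := lead_index sQ redQ.
have [j [dj wj _]] := wform_neq0 he.
exists J.+1 => _ N JN; exists ((((2 * N + 6) * n + j)%N)%:Z - (N * e)%:Z).
exists (wform (cD F) Q`_n`_e j (zD F) (tD F) * yD F ^+ n).
  by rewrite mulf_neq0 // expf_neq0 // yD_neq0.
move=> q th q0 [thC Lx Ly Lz Lt]; rewrite rE.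
have := lead_evy (rmorphD th) (rmorphM th) thC q0 Lx Ly Lz Lt sQ dQ JN e1 low dj.
rewrite expr1n mulr1 wform_polyC -polyC_exp -polyCM; apply: leadMn; lia.
Qed.

Section Fixed.
Variable phi : poly_hom R.
Hypothesis expphi : is_exponential phi.
Hypothesis xNinv : ~ phinv phi x.

Definition gen (i : 'I_4) : R := nth 0 [:: x; y; z; t] i.
Definition genD (i : 'I_4) : D := nth 0 [:: 1; yD F; zD F; tD F] i.
Definition genw N (i : 'I_4) : int := nth 0 [:: - N%:Z; (2 * N + 6)%:Z; 3; 2] i.

Lemma scaling_gen q N th i : scaling q N th -> lead (q%:Z * genw N i) (th (gen i)) (genD i)%:P.
Proof.
case=> _ Lx Ly Lz Lt; case: i => [[|[|[|[|i]]]]] p; rewrite /gen /genD /genw /=; last by case: (negP (isT : ~~ (i.+4 < 4)%N)).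
- by rewrite mulrN -PoszM.
- by rewrite -PoszM.
- by rewrite -PoszM.
- by rewrite -PoszM.
Qed.

(** The maximal slope is taken in [rat] but stated by cross multiplication, so that later weights
    stay integral. *)
Lemma slope_max (B : nat) (P : pred ('I_4 * 'I_B)) (W : 'I_4 * 'I_B -> int) u0 :
  P u0 -> (forall u, P u -> (0 < u.2)%N) ->
  exists2 u, P u & forall v, P v -> W v * u.2%:Z <= W u * v.2%:Z.
Proof.
move=> Pu0 Ppos.
case: (@arg_maxP _ rat _ u0 P (fun u => (W u)%:~R / (u.2%:Z)%:~R) Pu0) => u Pu umax.
exists u => // v Pv; have /= := umax v Pv.
rewrite ler_pdivrMr ?ltr0z ?ltz_nat ?Ppos // mulrAC ler_pdivlMr ?ltr0z ?ltz_nat ?Ppos //.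
by rewrite -!intrM ler_int.
Qed.

(* The leading form of [phi] for the weights [-N, 2N+6, 3, 2] of [x, y, z, t];
   the weight of [U] is the slope making it well defined and nontrivial. *)
Lemma homogenization (N : nat) :
  (forall i n, (phi (gen i))`_n != 0 ->
    exists w : int, exists2 l : D, l != 0 &
      forall q th, (0 < q)%N -> scaling q N th -> lead (q%:Z * w) (th (phi (gen i))`_n) l%:P) ->
  exists q th (Th : R -> E) (g : 'I_4 -> {poly D}),
    [/\ (0 < q)%N, scaling q N th,
        [/\ forall a b, Th (a + b) = Th a + Th b, forall a b, Th (a * b) = Th a * Th b,
            forall c : F, Th c%:A = tofrac (cDU c)%:P & forall a, phinv phi a -> Th a = th a],
        forall i, lead (q%:Z * genw N i) (Th (gen i)) (g i) /\ (g i)`_0 = genD i &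
        exists i, pdeg (g i) <> 0%N].
Proof.
move=> Hlead; pose B := (\max_(i < 4) size (phi (gen i)))%N.
have sB i : (size (phi (gen i)) <= B)%N by exact: (@leq_bigmax _ (fun i : 'I_4 => size (phi (gen i)))).
pose Dc (u : 'I_4 * 'I_B) := (phi (gen u.1))`_u.2.
have /choice[W HW] : forall u : 'I_4 * 'I_B, exists wl : int * D, Dc u != 0 -> wl.2 != 0 /\
    forall q th, (0 < q)%N -> scaling q N th -> lead (q%:Z * wl.1) (th (Dc u)) wl.2%:P.
  move=> u; have [Du|Du] := eqVneq (Dc u) 0; first by exists (0, 0).
  by have [w [l l0 H]] := Hlead _ _ Du; exists (w, l).
pose P (u : 'I_4 * 'I_B) := (0 < u.2)%N && (Dc u != 0).
have [u0 Pu0] : exists u0, P u0.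
  apply: contrapT => H; apply: xNinv; apply: (phinv_size expphi).
  apply/leq_sizeP => n n1; apply/eqP/negPn/negP => Dn.
  have nB : (n < B)%N.
    by rewrite ltnNge; apply: contra Dn => le; rewrite nth_default // (leq_trans (sB ord0)).
  by apply: H; exists (ord0, Ordinal nB); rewrite /P n1.
have [u Pu umax] := @slope_max B P (fun u => (W u).1 - genw N u.1) u0 Pu0 (fun u H => proj1 (andP H)).
have /andP[n0pos Du] := Pu.
(* The maximal slope is [p / q]. In weights multiplied by [q], sending [U] to [U eps^p] gives [U]
   the weight [- p]. *)
pose q : nat := u.2; pose p : int := (W u).1 - genw N u.1.
have [th Hth] := scaling_exists N n0pos.
pose v : E := tofrac ('X)%:P * eps ^ p.
have Lv : lead (- p) v 'X.
  by have := leadM (lead_tofrac ('X : {poly D})) (lead_eps {poly D} p); rewrite add0r mulr1.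
(* The coefficient of [U^n] contributes its leading form exactly when its slope is maximal; the
   other terms have smaller weight. *)
pose a (i : 'I_4) (n : nat) : D := if n == 0%N then genD i else
  if insub n is Some m then
    if (Dc (i, m) != 0) && (q%:Z * (W (i, m)).1 - p * n%:Z == q%:Z * genw N i) then (W (i, m)).2 else 0
  else 0.
exists q, th, (fun r => polyext th v (phi r)), (fun i => \poly_(n < B) a i n).
have B0 : (0 < B)%N by apply: leq_ltn_trans (ltn_ord u.2).
split=> //.
- split=> [r s|r s|c|r phinvr].
  + by rewrite phiD rmorphD.
  + by rewrite phiM rmorphM.
  + by rewrite phinvC polyextC (scalingC Hth).
  + by rewrite [phi r]phinvr polyextC.
- move=> i; split; last by rewrite coef_poly B0.
  rewrite (polyextE _ _ (sB i)) poly_def; apply: lead_sum => m _.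
  rewrite /a; case: (posnP m) => [->|mpos].
    rewrite expr0 mulr1 (phi_coef0 expphi) expr0 alg_polyC.
    exact: scaling_gen.
  rewrite valK.
  have [Dm|Dm] := eqVneq (Dc (i, m)) 0.
    have Dm' : (phi (gen i))`_m = 0 by exact: Dm.
    by rewrite /= scale0r Dm' rmorph0 mul0r; apply: lead0.
  rewrite /=; have [l0 Lm] := HW _ Dm.
  have {Lm} := Lm q th n0pos Hth; rewrite {1}/Dc /= => Lm.
  have le : q%:Z * (W (i, m)).1 + (- p *+ m) <= q%:Z * genw N i.
    have Pm : P (i, m) by rewrite /P Dm /= mpos.
    have := umax _ Pm; rewrite /= -/q -/p.
    rewrite -mulr_natr; lia.
  have := lead_le le (leadM Lm (leadXn m Lv)).
  rewrite -mulr_natr mulNr natz; case: eqP => _; first by rewrite mul_polyC.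
  by rewrite scale0r.
- exists u.1 => H; have [l0 _] := HW u Du.
  have sa : ((\poly_(n < B) a u.1 n)`_u.2 != 0).
    rewrite coef_poly ltn_ord /a gtn_eqF // valK -surjective_pairing.
    have E0 : q%:Z * (W u).1 - p * (u.2)%:Z == q%:Z * genw N u.1.
      by rewrite /p /q; apply/eqP; ring.
    by rewrite Du E0.
  case/eqP: sa; rewrite nth_default //.
  by move: n0pos; apply: leq_trans; move: H; case: (size _) => [|[|]].
Qed.

Lemma not_x_moved : False.
Proof.
have [f1 [Q1 [i1 f1E s1 red1]]] := phinv_positive pres expphi xNinv.
have [f2 [Q2 [i2 f2E nm2]]] := phinv_nonmonomial pres expphi xNinv.
have [J1 d1] := degleX_uniform Q1; have [J2 d2] := degleX_uniform Q2.
have /choice[N0 HN0] := lead_exists.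
pose B := (\max_(i < 4) size (phi (gen i)))%N.
(* [N] exceeds the degrees of both witnesses and every threshold attached to a coefficient of [phi]
   on the generators. *)
pose N := (J1 + J2 + 1 + \sum_(i < 4) \sum_(n < B) N0 ((phi (gen i))`_n)%R)%N.
have [|q [th [Th [g [q0 Hth [ThD ThM ThC Thinv] Hg [i gi]]]]]] := @homogenization N.
  move=> i n Dn; apply: (HN0 _ Dn).
  have nB : (n < B)%N.
    rewrite ltnNge; apply: contra Dn => le; rewrite nth_default //.
    by apply: leq_trans le; exact: (@leq_bigmax _ (fun i : 'I_4 => size (phi (gen i)))).
  rewrite /N (bigD1 i) //= (bigD1 (Ordinal nB)) //=; lia.
have [[Lx x0] [Ly y0] [Lz z0] [Lt t0]] :
  [/\ lead (q%:Z * - N%:Z) (Th x) (g (@Ordinal 4 0 isT)) /\ (g (@Ordinal 4 0 isT))`_0 = 1,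
      lead (q%:Z * (2 * N + 6)%:Z) (Th y) (g (@Ordinal 4 1 isT)) /\ (g (@Ordinal 4 1 isT))`_0 = yD F,
      lead (q%:Z * 3) (Th z) (g (@Ordinal 4 2 isT)) /\ (g (@Ordinal 4 2 isT))`_0 = zD F &
      lead (q%:Z * 2) (Th t) (g (@Ordinal 4 3 isT)) /\ (g (@Ordinal 4 3 isT))`_0 = tD F].
  by split; [have := Hg (@Ordinal 4 0 isT)|have := Hg (@Ordinal 4 1 isT)|
    have := Hg (@Ordinal 4 2 isT)|have := Hg (@Ordinal 4 3 isT)].
have gcases : [/\ pdeg (g (@Ordinal 4 0 isT)) = 0, pdeg (g (@Ordinal 4 1 isT)) = 0,
    pdeg (g (@Ordinal 4 2 isT)) = 0 & pdeg (g (@Ordinal 4 3 isT)) = 0]%N -> False.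
  move=> [G0 G1 G2 G3]; apply: gi; case: i => [[|[|[|[|//]]]]] pi.
  - by rewrite (_ : Ordinal pi = @Ordinal 4 0 isT) //; apply: val_inj.
  - by rewrite (_ : Ordinal pi = @Ordinal 4 1 isT) //; apply: val_inj.
  - by rewrite (_ : Ordinal pi = @Ordinal 4 2 isT) //; apply: val_inj.
  - by rewrite (_ : Ordinal pi = @Ordinal 4 3 isT) //; apply: val_inj.
move: (g (@Ordinal 4 0 isT)) (g (@Ordinal 4 1 isT)) (g (@Ordinal 4 2 isT)) (g (@Ordinal 4 3 isT))
  Lx x0 Ly y0 Lz z0 Lt t0 gcases => xh yh zh tt Lx x0 Ly y0 Lz z0 Lt t0 gcases {Hg gi i g}.
have {}Lx : lead (- (q * N)%:Z) (Th x) xh by apply: leadMn Lx; lia.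
have {}Ly : lead (q * (2 * N + 6))%:Z (Th y) yh by apply: leadMn Ly; lia.
have {}Lz : lead (q * 3)%:Z (Th z) zh by apply: leadMn Lz; lia.
have {}Lt : lead (q * 2)%:Z (Th t) tt by apply: leadMn Lt; lia.
have rel := lead_relation ThD ThM ThC q0 Lx Ly Lz Lt (pres_rel pres).
(* On an invariant [Th] agrees with [th], so the two computations of its leading form coincide, and
   the form is free of [U] along the curve. *)
have wit f (Q : {poly C}) n e j J : phinv phi f -> f = evy Q -> size Q = n.+1 ->
    (forall i, degleX Q`_i J) -> (J < N)%N -> (e <= 1)%N || (n == 0)%N ->
    (forall l, (l < e)%N -> Q`_n`_l = 0) -> degle Q`_n`_e j ->
    wform cDU Q`_n`_e j zh tt * xh ^+ e * yh ^+ n =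
    (wform (cD F) Q`_n`_e j (zD F) (tD F) * yD F ^+ n)%:P.
  move=> fi fE sQ dQ JN e1 low dj.
  have L := lead_evy ThD ThM ThC q0 Lx Ly Lz Lt sQ dQ JN e1 low dj.
  case: Hth => thC lx ly lz lt.
  have L' := lead_evy (rmorphD th) (rmorphM th) thC q0 lx ly lz lt sQ dQ JN e1 low dj.
  rewrite -fE Thinv // in L; rewrite -fE in L'.
  rewrite (lead_uniq L L') expr1n mulr1 wform_polyC -polyC_exp -polyCM //.
have wn0 (w : D) n : w != 0 -> w * yD F ^+ n != 0 by move=> w0; rewrite mulf_neq0 // expf_neq0 // yD_neq0.
(* The first witness has a leading form divisible by [y], so [yh] divides a nonzero [U]-constant. *)
have yc : pdeg yh = 0%N.
  have [n sQ] : exists n, size Q1 = n.+2 by exists (size Q1).-2; lia.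
  have [e [e1 low he]] := lead_index sQ red1.
  have [j [dj wj _]] := wform_neq0 he.
  have H := wit _ _ _ _ _ _ i1 f1E sQ d1 (ltac:(rewrite /N; lia)) e1 low dj.
  apply: (pdeg_dvdC (wn0 _ n.+1 wj) (q := wform cDU Q1`_n.+1`_e j zh tt * xh ^+ e * yh ^+ n)).
  by rewrite -H exprS; ring.
have yE := pdeg0_size yc; rewrite y0 in yE; rewrite yE in rel.
suff H : pdeg xh = 0%N \/ exists h j (c : D), [/\ (0 < j)%N, c != 0 & wform cDU h j zh tt = c%:P].
  have [xc zc tc] : [/\ pdeg xh = 0%N, pdeg zh = 0%N & pdeg tt = 0%N].
    case: H => [xc|[h [j [c H]]]].
      by apply: (no_affine_line (h := 0) (j := 0%N) (c := 0)) => //; left.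
    by apply: (no_affine_line (h := h) (j := j) (c := c)) => //; right.
  exact: gcases.
(* For the second witness, either a non-scalar coefficient gives a constant form of positive weight,
   or a factor [x] in the leading form makes [xh] a divisor of a [U]-constant. *)
case: nm2 => [nk|[s2 c0 c1]].
  have [n sQ] : exists n, size Q2 = n.+1.
    exists (size Q2).-1; rewrite prednK // size_poly_gt0; apply/eqP => Q0.
    by apply: (nk 0); rewrite Q0 lead_coef0 coef0 rmorph0.
  rewrite lead_coefE sQ /= in nk.
  have h0 : Q2`_n`_0 != 0 by apply/eqP => H; apply: (nk 0); rewrite H rmorph0.
  have [j [dj wj j0]] := wform_neq0 h0.
  have H := wit _ _ _ 0%N _ _ i2 f2E sQ d2 (ltac:(rewrite /N; lia)) isT (fun l => fun (lt : (l < 0)%N) => ltac:(done)) dj.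
  right; exists Q2`_n`_0, j.
  have wc : pdeg (wform cDU Q2`_n`_0 j zh tt) = 0%N.
    by apply: (pdeg_dvdC (wn0 _ n wj) (q := xh ^+ 0 * yh ^+ n)); rewrite -H mulrA.
  exists (wform cDU Q2`_n`_0 j zh tt)`_0; split; [exact: j0| |exact: pdeg0_size].
  apply/eqP => w0; have := wn0 _ n wj; have := H; rewrite (pdeg0_size wc) w0 polyC0 !mul0r => /esym/eqP.
  by rewrite polyC_eq0 => ->.
left; have [n sQ] : exists n, size Q2 = n.+2 by exists (size Q2).-2; lia.
rewrite lead_coefE sQ /= in c0 c1.
have [j [dj wj _]] := wform_neq0 c1.
have low l : (l < 1)%N -> Q2`_n.+1`_l = 0 by case: l.
have H := wit _ _ _ 1%N _ _ i2 f2E sQ d2 (ltac:(rewrite /N; lia)) isT low dj.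
apply: (pdeg_dvdC (wn0 _ n.+1 wj) (q := wform cDU Q2`_n.+1`_1 j zh tt * yh ^+ n.+1)).
by rewrite -H expr1; ring.
Qed.

End Fixed.

Theorem x_fixed (phi : poly_hom R) : is_exponential phi -> phi x = x%:P.
Proof. by move=> expphi; apply: contrapT; apply: not_x_moved. Qed.

End Degeneration.

(** * Two exponential maps *)

Section Coassociativity.
Variable B : comNzRingType.

Lemma coef_binomial n i j :
  (('X + 'X%:P) ^+ n : {poly {poly B}})`_j`_i = (if n == (i + j)%N then 'C(n, i)%:R else 0).
Proof.
rewrite exprDn !coef_sum.
have E (k : nat) : (k < n.+1)%N -> (('X ^+ (n - k) * 'X%:P ^+ k *+ 'C(n, k) : {poly {poly B}}))`_j`_i =
   if (k == i) && (n == i + j)%N then 'C(n, i)%:R else 0.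
  move=> kn; rewrite -polyC_exp !coefMn coefMC coefXn.
  have [->|jn] := eqVneq j (n - k)%N.
    rewrite mul1r coefXn; have [->|ik] := eqVneq i k.
      by rewrite subnKC // eqxx.
    by rewrite mul0rn.
  rewrite mul0r coef0 mul0rn; case: ifP => // /andP[/eqP ki /eqP nij].
  by case/eqP: jn; lia.
transitivity (\sum_(k < n.+1) (if (nat_of_ord k == i) && (n == i + j)%N then ('C(n, i)%:R : B) else 0)).
  by apply: eq_bigr => k _; rewrite E.
case: eqP => [nij|_]; last by rewrite big1 // => k _; rewrite andbF.
have lt : (i < n.+1)%N by lia.
rewrite (bigD1 (Ordinal lt)) //= eqxx big1 ?addr0 // => k ne.
by rewrite -val_eqE /= in ne; rewrite (negPf ne).
Qed.

Definition polyCC : {rmorphism B -> {poly {poly B}}} := polyC \o polyC.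

(** The substitution of [U + V] for [U]. Comparing coefficients, iterativity of [g] reads
    [coact g (g a) = comult (g a)]; both sides are ring morphisms in [a], so generators suffice. *)
Definition comult : {rmorphism {poly B} -> {poly {poly B}}} := polyext polyCC ('X + 'X%:P).

Lemma coef_comult p i j : (comult p)`_j`_i = p`_(i + j) *+ 'C(i + j, i).
Proof.
rewrite (polyextE _ _ (leqnn _)) !coef_sum.
transitivity (\sum_(k < size p) (if nat_of_ord k == (i + j)%N then p`_k *+ 'C(k, i) else 0)).
  apply: eq_bigr => k _; rewrite !coefCM coef_binomial.
  by case: eqP => _; rewrite ?mulr0 // mulr_natr.
have [lt|ge] := ltnP (i + j) (size p).
  rewrite (bigD1 (Ordinal lt)) //= eqxx big1 ?addr0 // => k ne.
  by rewrite -val_eqE /= in ne; rewrite (negPf ne).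
rewrite nth_default // mul0rn big1 // => k _; rewrite ltn_eqF //.
exact: leq_trans ge.
Qed.

Variable g : {rmorphism B -> {poly B}}.

Definition coact : {rmorphism {poly B} -> {poly {poly B}}} := polyext (polyC \o g) 'X.

Lemma coef_coact p j : (coact p)`_j = g p`_j.
Proof.
rewrite (polyextE _ _ (leqnn _)) coef_sum.
transitivity (\sum_(k < size p) (if nat_of_ord k == j then g p`_k else 0)).
  apply: eq_bigr => k _; rewrite coefCM coefXn eq_sym.
  by case: eqP => _; rewrite ?mulr1 ?mulr0.
have [lt|ge] := ltnP j (size p).
  rewrite (bigD1 (Ordinal lt)) //= eqxx big1 ?addr0 // => k ne.
  by rewrite -val_eqE /= in ne; rewrite (negPf ne).
rewrite nth_default // rmorph0 big1 // => k _; rewrite ltn_eqF //.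
exact: leq_trans ge.
Qed.

Lemma coactC c : coact c%:P = (g c)%:P.
Proof. exact: (polyextC (polyC \o g) 'X c). Qed.

Lemma coactX : coact 'X = 'X.
Proof. exact: polyextX. Qed.

Lemma comultC c : comult c%:P = c%:P%:P.
Proof. exact: (polyextC polyCC _ c). Qed.

Lemma comultX : comult 'X = 'X + 'X%:P.
Proof. exact: polyextX. Qed.

Lemma coact_const a : g a = a%:P -> coact (g a) = a%:P%:P /\ comult (g a) = a%:P%:P.
Proof. by move=> ga; rewrite ga coactC comultC ga. Qed.

Lemma coact_translation w e : g e = e%:P -> g w = w%:P + e%:P * 'X ->
  coact (g w) = comult (g w).
Proof.
move=> ge gw; rewrite gw !rmorphD !rmorphM coactX comultX !coactC !comultC ge gw.
rewrite (polyCD w%:P) polyCM; ring.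
Qed.

End Coassociativity.

Lemma coef_translation (B : comNzRingType) n (a : nat -> B) (w c : B) :
  (\sum_(i < n.+1) (a i)%:P * (w%:P + c%:P * 'X) ^+ i)`_n = a n * c ^+ n.
Proof.
have sL : (size (w%:P + c%:P * 'X)%R <= 2)%N.
  rewrite addrC -cons_poly_def size_cons_poly; case: ifP => // _.
  by rewrite ltnS size_polyC_leq1.
have L i := coefXn_top i sL.
have cL : (w%:P + c%:P * 'X)`_1 = c by rewrite coefD coefC coefCM coefX /= mulr1 add0r.
rewrite coef_sum big_ord_recr /= big1 ?add0r => [|i _].
  by have [H _] := L n; rewrite muln1 in H; rewrite coefCM H cL.
have [_ H] := L i; rewrite muln1 in H.
by rewrite coefCM [X in _ * X]nth_default ?mulr0 // (leq_trans H).
Qed.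

Section Translations.
Variables (F : fieldType) (eta : {poly F}) (R : comAlgType F) (x y z t : R).
Hypothesis pres : presentation eta x y z t.
Local Notation C := {poly {poly {poly F}}}.
Local Notation embx := (embx x z t).
Local Notation evy := (evy x y z t).

Lemma rmorph_horner_alg (T : comNzRingType) (f g : {rmorphism R -> T}) (p : {poly F}) :
  (forall c : F, f c%:A = g c%:A) -> f x = g x -> f (horner_alg x p) = g (horner_alg x p).
Proof.
move=> fgC fgx; elim/poly_ind: p => [|p c IH]; first by rewrite !rmorph0.
by rewrite horner_alg_MXaddC !rmorphD !rmorphM IH fgx fgC.
Qed.

(* [y] is determined by [x^2 y = - z^2 - t^3 - eta(x)]. *)
Lemma rmorph_ext (T : comNzRingType) (f g : {rmorphism R -> T}) :
  (forall a b, f x * a = f x * b -> a = b) ->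
  (forall c : F, f c%:A = g c%:A) -> f x = g x -> f z = g z -> f t = g t -> f =1 g.
Proof.
move=> xreg fgC fgx fgz fgt.
have fgy : f y = g y.
  apply/xreg/xreg; have yE : x ^+ 2 * y = - (z ^+ 2 + t ^+ 3 + horner_alg x eta).
    by apply/eqP; rewrite -subr_eq0 opprK !addrA; apply/eqP; apply: pres_rel pres.
  rewrite !mulrA -expr2; transitivity (f (x ^+ 2 * y)); first by rewrite rmorphM rmorphXn.
  transitivity (g (x ^+ 2 * y)); last by rewrite rmorphM rmorphXn fgx.
  by rewrite yE !rmorphN !rmorphD !rmorphXn fgz fgt (rmorph_horner_alg eta fgC fgx).
move=> r; apply: (pres_ind pres (P := fun r => f r = g r)) r => //.
  by move=> a b fa fb; rewrite !rmorphD fa fb.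
by move=> a b fa fb; rewrite !rmorphM fa fb.
Qed.

Lemma mulfI_R (a b : R) : x * a = x * b -> a = b.
Proof.
move=> /eqP; rewrite -subr_eq0 -mulrBr => /eqP /(domain_R pres)[/eqP|/eqP].
  by rewrite (negPf (x_neq0 pres)).
by rewrite subr_eq0 => /eqP.
Qed.

Lemma mulfI_polyC (A : comNzRingType) (c : A) (p q : {poly A}) :
  (forall a b, c * a = c * b -> a = b) -> c%:P * p = c%:P * q -> p = q.
Proof.
by move=> creg E; apply/polyP => i; apply: creg; rewrite -!coefCM E.
Qed.

Lemma poly_hom_exists (g : {rmorphism R -> {poly R}}) :
  (forall c : F, g c%:A = (c%:A)%:P) -> exists phi : poly_hom R, phi =1 g.
Proof.
move=> gC.
have gZ : scalable_for (in_alg R \; *:%R) g.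
  by move=> c r; rewrite -mulr_algl rmorphM gC mul_polyC.
pose M := GRing.isScalable.Build F R {poly R} (in_alg R \; *:%R) g gZ.
pose phi : poly_hom R := HB.pack (g : R -> {poly R}) (GRing.RMorphism.class g) M.
by exists phi.
Qed.

(** Both axioms are equalities of ring morphisms out of [R]. They are checked on scalars, [x], [z]
    and [t], since the image of [x] is regular in either target and this determines the image of
    [y]. *)
Lemma exponential_criterion (g : {rmorphism R -> {poly R}}) :
  (forall c : F, g c%:A = (c%:A)%:P) -> g x = x%:P ->
  (forall w, w = z \/ w = t -> exists c : F, g w = w%:P + (c%:A * x ^+ 2)%:P * 'X) ->
  exists2 phi : poly_hom R, phi =1 g & is_exponential phi.
Proof.
move=> gC gx gzt; have [phi phiE] := poly_hom_exists gC; exists phi => //; split.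
  move=> a; rewrite phiE; pose h : {rmorphism R -> R} := horner_eval 0 \o g.
  have hE : h =1 idfun.
    have hw w : w = z \/ w = t -> h w = w.
      by move=> /gzt[c E]; rewrite /= horner_evalE E hornerD hornerC hornerM hornerX mulr0 addr0.
    have hx : h x = x by rewrite /= horner_evalE gx hornerC.
    apply: rmorph_ext => [u v|c||/=|/=]; rewrite ?hx; try exact: mulfI_R.
    - by rewrite /= horner_evalE gC hornerC.
    - by apply: hw; left.
    - by apply: hw; right.
  exact: hE.
pose G : {rmorphism R -> {poly {poly R}}} := coact g \o g.
pose H : {rmorphism R -> {poly {poly R}}} := comult R \o g.
have GH : G =1 H.
  have Gw w : w = z \/ w = t -> G w = H w.
    move=> /gzt[c E]; apply: (coact_translation (e := c%:A * x ^+ 2)) => //.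
    by rewrite rmorphM rmorphXn gC gx polyCM polyC_exp.
  have [Gx Hx] := coact_const gx.
  apply: rmorph_ext.
  - have GxE : G x = x%:P%:P by exact: Gx.
    move=> u v; rewrite GxE => E.
    by apply: (mulfI_polyC _ E) => u' v' E'; apply: (mulfI_polyC _ E'); apply: mulfI_R.
  - by move=> c; have [E1 E2] := coact_const (gC c); apply: etrans E1 (esym E2).
  - exact: etrans Gx (esym Hx).
  - by apply: Gw; left.
  - by apply: Gw; right.
move=> i j a; rewrite /poly_hom_coef !phiE -coef_comult -coef_coact.
by rewrite -[coact g (g a)]/(G a) GH.
Qed.

Lemma translate_z : exists2 phi : poly_hom R, is_exponential phi &
  phi z = z%:P + (x ^+ 2)%:P * 'X /\ forall a : R, (a = x \/ a = t) -> phi a = a%:P.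
Proof.
pose f : {rmorphism F -> {poly R}} := polyC \o in_alg R.
(* The correction to [y] is [((z + x^2 U)^2 - z^2) / x^2]; the factor [x^2] of the translation makes
   this quotient a polynomial. *)
have [|g [gC [gx gy gz gt]]] := pres_lift pres (f := f) (vx := x%:P)
  (vy := y%:P - ((2%:R * z)%:P * 'X + (x ^+ 2)%:P * 'X^2)) (vz := z%:P + (x ^+ 2)%:P * 'X) (vt := t%:P).
  have -> : (map_poly f eta).[x%:P] = (horner_alg x eta)%:P.
    elim/poly_ind: eta => [|p c IH]; first by rewrite !rmorph0 horner0.
    by rewrite map_poly_MXaddC hornerMXaddC IH horner_alg_MXaddC polyCD polyCM.
  transitivity ((x ^+ 2 * y + z ^+ 2 + t ^+ 3 + horner_alg x eta)%:P); last by rewrite (pres_rel pres).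
  by rewrite !polyCD (polyCM (x ^+ 2) y) (polyCM 2%:R z) !polyC_exp polyC_natr; ring.
have [|phi phiE expphi] := exponential_criterion gC gx.
  move=> w [] ->; first by exists 1; rewrite scale1r mul1r.
  by exists 0; rewrite scale0r mul0r polyC0 mul0r addr0.
by exists phi => //; rewrite !phiE; split=> // a [->|->]; rewrite phiE.
Qed.

Lemma translate_t : exists2 phi : poly_hom R, is_exponential phi &
  phi t = t%:P + (x ^+ 2)%:P * 'X /\ forall a : R, (a = x \/ a = z) -> phi a = a%:P.
Proof.
pose f : {rmorphism F -> {poly R}} := polyC \o in_alg R.
(* Here the correction to [y] is [((t + x^2 U)^3 - t^3) / x^2]. *)
have [|g [gC [gx gy gz gt]]] := pres_lift pres (f := f) (vx := x%:P)
  (vy := y%:P - ((3%:R * t ^+ 2)%:P * 'X + (3%:R * t * x ^+ 2)%:P * 'X^2 + (x ^+ 4)%:P * 'X^3))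
  (vz := z%:P) (vt := t%:P + (x ^+ 2)%:P * 'X).
  have -> : (map_poly f eta).[x%:P] = (horner_alg x eta)%:P.
    elim/poly_ind: eta => [|p c IH]; first by rewrite !rmorph0 horner0.
    by rewrite map_poly_MXaddC hornerMXaddC IH horner_alg_MXaddC polyCD polyCM.
  transitivity ((x ^+ 2 * y + z ^+ 2 + t ^+ 3 + horner_alg x eta)%:P); last by rewrite (pres_rel pres).
  by rewrite !polyCD (polyCM (x ^+ 2) y) (polyCM 3%:R (t ^+ 2)) (polyCM (3%:R * t)) (polyCM 3%:R t)
    !polyC_exp !polyC_natr; ring.
have [|phi phiE expphi] := exponential_criterion gC gx.
  move=> w [] ->; first by exists 0; rewrite scale0r mul0r polyC0 mul0r addr0.
  by exists 1; rewrite scale1r mul1r.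
by exists phi => //; rewrite !phiE; split=> // a [->|->]; rewrite phiE.
Qed.

(* The leading coefficient in [U] of [phi (sum a_i w^i)] is [a_n x^(2n)]. *)
Lemma invariant_coef (phi : poly_hom R) (A : comNzRingType) (e : {rmorphism A -> R}) w (p : {poly A}) :
  phi w = w%:P + (x ^+ 2)%:P * 'X -> (forall a, phi (e a) = (e a)%:P) ->
  phi (polyext e w p) = (polyext e w p)%:P -> exists a, polyext e w p = e a.
Proof.
move=> phiw phie; have [n] := ubnP (size p); elim: n p => // n IH p sp.
have [s1|s1] := leqP (size p) 1; first by exists p`_0; rewrite {1}(size1_polyC s1) polyextC.
have [m sm] : exists m, size p = m.+2 by exists (size p).-2; lia.
have sm' : (size p <= m.+2)%N by rewrite sm.
move=> pinv; have e0 : e p`_m.+1 = 0.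
  have := congr1 (fun q : {poly R} => q`_m.+1) pinv; rewrite coefC /=.
  have -> : phi (polyext e w p) = \sum_(i < m.+2) (e p`_i)%:P * (w%:P + (x ^+ 2)%:P * 'X) ^+ i.
    rewrite (polyextE _ _ sm') -[LHS]/((phi : {rmorphism R -> {poly R}}) _) rmorph_sum.
    apply: eq_bigr => i _; apply: etrans (phiM _ _ _) _; rewrite phie; congr (_ * _).
    by apply: etrans (phiXn _ _ _) _; rewrite phiw.
  rewrite (coef_translation m.+1 (fun i => e p`_i)).
  move/(domain_R pres) => [//|/eqP]; rewrite -exprM; elim: (2 * m.+1)%N => [|k IHk].
    by rewrite expr0 oner_eq0.
  by rewrite exprS => /eqP/(domain_R pres)[/eqP|/eqP //]; rewrite (negPf (x_neq0 pres)).
pose p' := p - (p`_m.+1)%:P * 'X^(m.+1).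
have pp' : polyext e w p = polyext e w p'.
  by rewrite rmorphB rmorphM polyextC e0 mul0r subr0.
rewrite pp'; apply: IH; last by rewrite -pp'.
apply: leq_trans (_ : m.+2 <= n)%N; last by rewrite -sm.
rewrite ltnS; apply/leq_sizeP => j; rewrite coefB coefCM coefXn leq_eqVlt => /orP[/eqP <-|lt].
  by rewrite eqxx mulr1 subrr.
by rewrite nth_default ?sm // gtn_eqF // mulr0 subrr.
Qed.

Lemma polyext_closed (S : R -> Prop) (A : comNzRingType) (e : {rmorphism A -> R}) w :
  (forall a b, S a -> S b -> S (a + b)) -> (forall a b, S a -> S b -> S (a * b)) ->
  (forall a, S (e a)) -> S w -> forall p, S (polyext e w p).
Proof.
move=> SD SM Se Sw; elim/poly_ind => [|p c IH]; first by rewrite -polyC0 polyextC.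
by rewrite rmorphD rmorphM polyextX polyextC; apply: SD => //; apply: SM.
Qed.

(** [F[x, z, t]] is described again with [x] innermost and [t] outermost, so that each translation
    strips the outermost variable. *)
Definition embX : {rmorphism {poly F} -> R} := horner_alg x.
Definition embXZ : {rmorphism {poly {poly F}} -> R} := polyext embX z.
Definition embXZT : {rmorphism C -> R} := polyext embXZ t.

Lemma embx_range c : exists c', embx c = embXZT c'.
Proof.
have SD a b : (exists c', a = embXZT c') -> (exists c', b = embXZT c') -> exists c', a + b = embXZT c'.
  by move=> [p ->] [q ->]; exists (p + q); rewrite rmorphD.
have SM a b : (exists c', a = embXZT c') -> (exists c', b = embXZT c') -> exists c', a * b = embXZT c'.
  by move=> [p ->] [q ->]; exists (p * q); rewrite rmorphM.
apply: (polyext_closed (S := fun a => exists c', a = embXZT c')) c => //; last first.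
  by exists ('X%:P%:P); rewrite !polyextC [RHS]horner_algX.
apply: (polyext_closed (S := fun a => exists c', a = embXZT c')) => //; last first.
  by exists 'X; rewrite polyextX.
apply: (polyext_closed (S := fun a => exists c', a = embXZT c')) => // [k|].
  by exists (k%:P%:P%:P); rewrite (polyextC embXZ) (polyextC embX); apply: esym (horner_algC _ _).
by exists ('X%:P); rewrite polyextC polyextX.
Qed.

Lemma x_power_clear a : exists n c, a * x ^+ n = embx c.
Proof.
have [Q aE] := evy_surj pres a; exists (2 * size Q)%N, (Psi eta (size Q) Q).
apply: (iota_inj (pres := pres)); rewrite iota_embx -(iota_evy pres (leqnSn _)) aE rmorphM rmorphXn.
by rewrite iota_x.
Qed.

(** If [r] has [y]-degree [n + 1], then [x^(2n+2) r = k x^(2n+1)]. Modulo [x^2], reducedness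
    excludes [n > 0], and for [n = 0] it makes the scalar [k] a nonzero multiple of [W0], which has
    degree 3 in [t]. *)
Lemma x_not_unit r (k : F) : r * x = k%:A -> k = 0.
Proof.
move=> rx; have iE : iotaR pres r * tofrac 'X = tofrac (cD F k)%:P.
  by rewrite -(iota_x pres) -rmorphM rx iota_algC.
have [Q rE redQ] := reduced_form pres r.
have kc : (cD F k == 0) = (k == 0) by rewrite /= !polyC_eq0.
apply/eqP; rewrite -kc; have [sQ|s1] := leqP (size Q) 1.
  move: iE; rewrite rE (size1_polyC sQ) evyC iota_embx -tofracM => /eqP.
  rewrite tofrac_eq => /eqP/(congr1 (fun p : C => p`_0)).
  by rewrite coefMX coefC /= => <-.
have [n sQ] : exists n, size Q = n.+2 by exists (size Q).-2; lia.
have PE : Psi eta n.+1 Q = (cD F k)%:P * 'X^(2 * n + 1).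
  have sQ' : (size Q <= n.+2)%N by rewrite sQ.
  apply/eqP; rewrite -tofrac_eq -(iota_evy pres sQ') -rE tofracM tofracXn -iE -mulrA -exprS.
  by rewrite (_ : (2 * n.+1 = (2 * n + 1).+1)%N) //; lia.
have W0n := expf_neq0 n.+1 (W0_neq0 eta).
have q0 : (Q`_n.+1)`_0 = 0.
  have := Psi_coef0 eta n.+1 Q; rewrite PE coefMXn addn1 /= => /esym/eqP.
  by rewrite mulf_eq0 (negPf W0n) orbF => /eqP.
have q1 : (Q`_n.+1)`_1 != 0.
  by have := redQ; rewrite /reduced sQ lead_coefE sQ /= q0 eqxx => /(_ isT).
have := Psi_coef1 eta q0; rewrite PE coefMXn; case: n sQ PE W0n q0 q1 => [|n] sQ PE W0n q0 q1; last first.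
  rewrite ifT; last by lia.
  by move/esym/eqP; rewrite mulf_eq0 (negPf q1) (negPf W0n).
rewrite /= coefC expr1 => /(congr1 (fun p : {poly {poly F}} => size p)) sE.
have := size_polyC_leq1 (k%:P : {poly F}); rewrite [size _]sE size_mul ?W0_neq0 //.
have -> : size (W0 eta) = 4%N.
  rewrite size_polyN size_polyDl ?size_zt //.
  by rewrite (leq_ltn_trans (size_polyC_leq1 _)).
have arith m : (0 < m -> (m + 4).-1 <= 1 -> False)%N by lia.
by move: q1; rewrite -size_poly_gt0 => /arith H /H.
Qed.

Lemma embX_divx r p : r * x = embX p -> exists q, r = embX q.
Proof.
elim/poly_ind: p => [|p c _] E.
  exists 0; apply: mulfI_R; rewrite mulrC E !rmorph0 mulr0 //.
have E' : (r - embX p) * x = c%:A.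
  by rewrite mulrBl E [embX _]horner_alg_MXaddC -[embX p]/(horner_alg x p) addrC addKr.
exists p; have c0 := x_not_unit E'; move: E'; rewrite c0 scale0r mulrC => E'.
by apply/eqP; rewrite -subr_eq0; apply/eqP/mulfI_R; rewrite E' mulr0.
Qed.

Theorem AK_presentation : AK R =i gen_subalg x.
Proof.
move=> a; apply/idP/gen_subalgP => [/asboolP aAK|[p ->]]; last first.
  apply/asboolP => phi expphi; rewrite inE.
  have xinv := x_fixed pres expphi; apply/eqP.
  elim/poly_ind: p => [|p c IH]; first by rewrite !rmorph0.
  rewrite horner_alg_MXaddC phiD phiM IH xinv -/(phinv phi c%:A) polyCD polyCM.
  by congr (_ + _); apply: phinvC.
suff [q ->] : exists q, a = embX q by exists q.
(* A power of the invariant [x] moves [a] into [F[x, z, t]]. The two translations remove [t] and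
   then [z], and the power of [x] is finally divided out. *)
have [n [c cE]] := x_power_clear a; have [c' c'E] := embx_range c.
have inv_ac phi : is_exponential phi -> phinv phi (a * x ^+ n).
  move=> expphi; apply: phinvM; first by have := aAK phi expphi; rewrite inE => /eqP.
  by rewrite /phinv phiXn (x_fixed pres expphi) polyC_exp.
have [phit expt [tt tfix]] := translate_t; have [phiz expz [zz zfix]] := translate_z.
have fixX phi : is_exponential phi -> forall p, phinv phi (embX p).
  move=> expphi; elim/poly_ind => [|p k IH]; first by rewrite rmorph0; apply: phinv0.
  rewrite [embX _]horner_alg_MXaddC; apply: phinvD (phinvC _ _); apply: phinvM IH _.
  exact: (x_fixed pres expphi).
have [c1 c1E] : exists c1, embXZT c' = embXZ c1.
  apply: (invariant_coef tt); last by rewrite -/embXZT -c'E -cE; apply: inv_ac.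
  apply: (polyext_closed (S := phinv phit)); [exact: phinvD|exact: phinvM|exact: fixX|].
  by apply: tfix; right.
have [c0 c0E] : exists c0, embXZ c1 = embX c0.
  apply: (invariant_coef zz); last by rewrite -/embXZ -c1E -c'E -cE; apply: inv_ac.
  exact: fixX.
move: cE; rewrite c'E c1E c0E; elim: n {inv_ac} c0 {c0E} => [|n IH] c0 E.
  by exists c0; rewrite -E expr0 mulr1.
by have [|q E'] := @embX_divx (a * x ^+ n) c0; [rewrite -mulrA -exprSr|apply: IH E'].
Qed.

End Translations.

(** * The hypersurface ring *)

Section HypersurfacePresentation.
Variables (F : fieldType) (eta : {poly F}).
Local Notation R := (hyp_ring eta).
Local Notation pi := (@hyp_pi F eta).

Let piD p q : pi (p + q) = pi p + pi q. Proof. exact: rmorphD. Qed.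
Let piM p q : pi (p * q) = pi p * pi q. Proof. exact: rmorphM. Qed.
Let piB p q : pi (p - q) = pi p - pi q. Proof. exact: rmorphB. Qed.
Let pi1 : pi 1 = 1. Proof. exact: rmorph1. Qed.
Let pi0 : pi 0 = 0. Proof. exact: rmorph0. Qed.
Let piXn p n : pi (p ^+ n) = pi p ^+ n. Proof. exact: rmorphXn. Qed.
Let piZ c p : pi (c *: p) = c *: pi p. Proof. exact: hyp_pi_is_scalable. Qed.

Lemma hyp_pi_horner_alg (q : {mpoly F[4]}) (p : {poly F}) :
  pi (horner_alg q p) = horner_alg (pi q) p.
Proof.
elim/poly_ind: p => [|p c IH]; first by rewrite !rmorph0 ?pi0.
have E : horner_alg q (p * 'X + c%:P) = horner_alg q p * q + c%:A.
  by rewrite rmorphD rmorphM /= horner_algX horner_algC.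
by rewrite E horner_alg_MXaddC piD piM IH piZ pi1.
Qed.

Section Lift.
Variables (T : comNzRingType) (f : {rmorphism F -> T}) (v : 'I_4 -> T).
Hypothesis vrel : mmap f v (hyp_poly eta) = 0.

(** Evaluates a chosen representative; the choice is immaterial because the evaluation kills
    [hyp_poly]. *)
Definition hyp_lift (r : R) : T := mmap f v (repr r).

Lemma hyp_liftE p : hyp_lift (pi p) = mmap f v p.
Proof.
have /hyp_pi_eq0[q E] : pi (repr (pi p) - p) = 0.
  by rewrite piB /hyp_pi reprK subrr.
apply/eqP; rewrite -subr_eq0 /hyp_lift -rmorphB E rmorphM /= vrel mulr0.
by [].
Qed.

Lemma hyp_lift_zmod : zmod_morphism hyp_lift.
Proof.
move=> r s; have [p ->] := hyp_pi_surj r; have [q ->] := hyp_pi_surj s.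
by rewrite -piB !hyp_liftE rmorphB.
Qed.

Lemma hyp_lift_monoid : monoid_morphism hyp_lift.
Proof.
split; first by rewrite -pi1 hyp_liftE rmorph1.
move=> r s; have [p ->] := hyp_pi_surj r; have [q ->] := hyp_pi_surj s.
by rewrite -piM !hyp_liftE rmorphM.
Qed.

HB.instance Definition _ := GRing.isZmodMorphism.Build R T hyp_lift hyp_lift_zmod.
HB.instance Definition _ := GRing.isMonoidMorphism.Build R T hyp_lift hyp_lift_monoid.

Lemma hyp_lift_exists : exists2 g : {rmorphism R -> T},
  (forall c : F, g c%:A = f c) & forall i, g (pi 'X_i) = v i.
Proof.
exists hyp_lift => [c|i].
  have -> : (c%:A : R) = pi c%:MP by rewrite /GRing.scale /= /hyp_scale mulr1.
  by rewrite [LHS]hyp_liftE mmapC.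
by rewrite [LHS]hyp_liftE mmapX mmap1U.
Qed.

End Lift.

Lemma mmap_horner_alg (T : comNzRingType) (f : {rmorphism F -> T}) (v : 'I_4 -> T)
    (q : {mpoly F[4]}) (p : {poly F}) :
  mmap f v (horner_alg q p) = (map_poly f p).[mmap f v q].
Proof.
elim/poly_ind: p => [|p c IH]; first by rewrite !rmorph0 horner0.
have E : horner_alg q (p * 'X + c%:P) = horner_alg q p * q + c%:A.
  by rewrite rmorphD rmorphM /= horner_algX horner_algC.
have mM a b : mmap f v (a * b) = mmap f v a * mmap f v b by exact: rmorphM.
rewrite E map_poly_MXaddC hornerMXaddC mmapD mM IH.
by congr (_ + _); rewrite mmapZ rmorph1 mulr1.
Qed.

Lemma hyp_presentation :
  presentation eta (hyp_x eta) (pi 'X_1) (pi 'X_2) (pi 'X_3).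
Proof.
split.
- have : pi (hyp_poly eta) = 0 by apply/hyp_pi_eq0; exists 1; rewrite mul1r.
  by rewrite /hyp_poly !piD piM !piXn hyp_pi_horner_alg.
- move=> P PC Px Py Pz Pt PD PM r; have [p ->] := hyp_pi_surj r.
  have PX (i : 'I_4) : P (pi 'X_i).
    case: i => [[|[|[|[|i]]]] li]; last by [].
    + by rewrite (_ : Ordinal li = 0) //; apply: val_inj.
    + by rewrite (_ : Ordinal li = 1) //; apply: val_inj.
    + by rewrite (_ : Ordinal li = 2) //; apply: val_inj.
    + by rewrite (_ : Ordinal li = 3) //; apply: val_inj.
  have P1 : P 1 by have := PC 1; rewrite scale1r.
  have P0 : P 0 by have := PC 0; rewrite scale0r.
  elim/mpolyind: p => [|c m p _ _ IH]; first by rewrite pi0.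
  rewrite piD; apply: PD IH; rewrite piZ -mulr_algl; apply: (PM) => //.
  rewrite mpolyXE_id (big_morph pi piM pi1); apply: (big_ind P); [exact: P1|exact: PM|move=> i _].
  rewrite piXn; elim: (m i) => [|k IHk]; first by rewrite expr0.
  by rewrite exprS; apply: (PM).
move=> T f vx vy vz vt vrel.
pose v (i : 'I_4) := nth 0 [:: vx; vy; vz; vt] i.
have [|g gC gX] := @hyp_lift_exists T f v.
  rewrite /hyp_poly !rmorphD rmorphM !rmorphXn /= mmap_horner_alg !mmapX !mmap1U.
  exact: vrel.
by exists g; split=> //; split; apply: gX.
Qed.

End HypersurfacePresentation.

(** * The absolute constants as a polynomial algebra *)

Section AbsoluteConstants.
Variables (F : fieldType) (eta : {poly F}).
Local Notation A := (AK_alg (hyp_ring eta)).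

Lemma AK_horner (p : {poly F}) : horner_alg (hyp_x eta) p \in AK (hyp_ring eta).
Proof.
rewrite (AK_presentation (hyp_presentation eta)); apply/gen_subalgP.
by exists p.
Qed.

Definition AK_poly (p : {poly F}) : A := AKAlg (AK_horner p).

Lemma AK_poly_zmod : zmod_morphism AK_poly.
Proof. by move=> p q; apply: val_inj; rewrite rmorphB /= rmorphB. Qed.

Lemma AK_poly_monoid : monoid_morphism AK_poly.
Proof.
split; first by apply: val_inj; rewrite rmorph1 /= rmorph1.
by move=> p q; apply: val_inj; rewrite rmorphM /= rmorphM.
Qed.

Lemma AK_poly_scalable : scalable AK_poly.
Proof. by move=> c p; apply: val_inj; rewrite [RHS]linearZ /= [LHS]linearZ /= mulr_algl. Qed.

HB.instance Definition _ := GRing.isZmodMorphism.Build {poly F} A AK_poly AK_poly_zmod.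
HB.instance Definition _ := GRing.isMonoidMorphism.Build {poly F} A AK_poly AK_poly_monoid.
HB.instance Definition _ := GRing.isScalable.Build F {poly F} A *:%R AK_poly AK_poly_scalable.

(** [x] is transcendental over [F] because [F[x, z, t]] embeds in [R]. *)
Lemma AK_poly_inj : injective AK_poly.
Proof.
move=> p q /(congr1 val) E; pose pres := hyp_presentation eta.
have emb r : horner_alg (hyp_x eta) r = embx (hyp_x eta) (hyp_pi eta 'X_2) (hyp_pi eta 'X_3) (map_poly (cD F) r).
  elim/poly_ind: r => [|r c IH]; first by rewrite !rmorph0.
  by rewrite map_poly_MXaddC horner_alg_MXaddC rmorphD rmorphM embxX embxC embtC embzC IH.
have {}E : map_poly (cD F) p = map_poly (cD F) q.
  by apply: (embx_inj pres); rewrite -!emb; apply: E.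
apply/polyP => i; have := congr1 (fun r : {poly {poly {poly F}}} => r`_i`_0`_0) E.
by rewrite !coef_map /= !coefC.
Qed.

Lemma AK_poly_surj (a : A) : {p | a = AK_poly p}.
Proof.
apply: cid; have /gen_subalgP[p pE] : val a \in gen_subalg (hyp_x eta).
  by rewrite -(AK_presentation (hyp_presentation eta)); apply: valP.
by exists p; apply: val_inj.
Qed.

Definition AK_coord (a : A) : {poly F} := sval (AK_poly_surj a).

Lemma AK_coordK : cancel AK_coord AK_poly.
Proof. by move=> a; rewrite /AK_coord; case: (AK_poly_surj a). Qed.

Lemma AK_polyK : cancel AK_poly AK_coord.
Proof. by move=> p; apply: AK_poly_inj; rewrite AK_coordK. Qed.

Lemma AK_coord_zmod : zmod_morphism AK_coord.
Proof. by move=> a b; apply: AK_poly_inj; rewrite [RHS]rmorphB /= !AK_coordK. Qed.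

Lemma AK_coord_monoid : monoid_morphism AK_coord.
Proof.
split; first by apply: AK_poly_inj; rewrite AK_coordK [RHS]rmorph1.
by move=> a b; apply: AK_poly_inj; rewrite [RHS]rmorphM /= !AK_coordK.
Qed.

Lemma AK_coord_scalable : scalable AK_coord.
Proof. by move=> c a; apply: AK_poly_inj; rewrite [RHS]linearZ /= !AK_coordK. Qed.

HB.instance Definition _ := GRing.isZmodMorphism.Build A {poly F} AK_coord AK_coord_zmod.
HB.instance Definition _ := GRing.isMonoidMorphism.Build A {poly F} AK_coord AK_coord_monoid.
HB.instance Definition _ := GRing.isScalable.Build F A {poly F} *:%R AK_coord AK_coord_scalable.

End AbsoluteConstants.

Theorem mainTheorem2 (F : fieldType) :
  (forall eta : {poly F}, AK (hyp_ring eta) =i gen_subalg (hyp_x eta)) /\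
  (exists f : {lrmorphism {poly F} -> AK_alg (hyp_ring (0 : {poly F}))},
     [/\ bijective f,
         AK_val (f 'X) = hyp_x 0
       & forall eta : {poly F},
           exists g : {lrmorphism AK_alg (hyp_ring (0 : {poly F})) ->
                                  AK_alg (hyp_ring eta)},
             bijective g /\ AK_val (g (f 'X)) = hyp_x eta]).
Proof.
have polyX eta : AK_val (AK_poly eta 'X) = hyp_x eta by exact: horner_algX.
split=> [eta|]; first exact: AK_presentation (hyp_presentation eta).
exists (@AK_poly F 0); split.
- by exists (@AK_coord F 0); [apply: AK_polyK|apply: AK_coordK].
- exact: polyX.
move=> eta; exists (@AK_poly F eta \o @AK_coord F 0); split.
  exists (@AK_poly F 0 \o @AK_coord F eta) => a /=.
    by rewrite AK_polyK AK_coordK.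
  by rewrite AK_polyK AK_coordK.
by rewrite /= AK_polyK; apply: polyX.
Qed.
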